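(* Assume $\mathbb{E}[V(yZ_T^0)]<\infty$ for every $y>0$. Then for every $x_0\in(0,\infty)$ there exists $\hat f\in\mathcal C(x_0)$ such that $u(x_0,U)=\mathbb{E}[U(\hat f)]$.
   Context: Fix $T>0$ and a filtered probability space $(\Omega,\mathcal F,(\mathcal F_t)_{0\le t\le T},\mathbf P)$ satisfying the usual conditions. Fix $0<\lambda<1$ and a strictly positive càdlàg adapted stock price $S$ with ask price $S_t$ and bid price $(1-\lambda)S_t$. A $\lambda$-consistent price system is a strictly positive process $Z=(Z^0,Z^1)$ with $Z^0_0=1$, $Z^0$ a $\mathbf P$-martingale, $Z^1$ a $\mathbf P$-local martingale, and $Z^1_t/Z^0_t\in[(1-\lambda)S_t,S_t]$ a.s. for all $t$. Standing assumption: one such $Z$ is fixed, and $\mathbf Q$ denotes the probability measure with $d\mathbf Q/d\mathbf P=Z_T^0$ (equivalent to $\mathbf P$). Following the paper (which works under this one fixed consistent price system), the set of attainable terminal liquidation values with initial capital $x>0$ is $\mathcal C(x)=\{f\in L^0_+(\mathbf P):\mathbb{E}[Z_T^0 f]\le x\}$. A utility is a function $U:(0,\infty)\to\mathbb R$ that is non-constant, increasing, upper semicontinuous, with $U(\infty):=\lim_{x\to\infty}U(x)>0$ and satisfying the growth condition $\lim_{x\to\infty}U(x)/x=0$; $U$ is not assumed concave or differentiable. Set $U(0):=\lim_{x\downarrow 0}U(x)$ and $U:=-\infty$ on $(-\infty,0)$. For a random variable $f\ge 0$, $\mathbb{E}[U(f)]:=-\infty$ if $U^-(f)\notin L^1$.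 The value function is $u(x,U):=\sup\{\mathbb{E}[U(f)]: f\in\mathcal C(x)\}$. The convex conjugate of $U$ is $V(y):=\sup_{x>0}\{U(x)-xy\}$, $y>0$. *)

(* Defs.v *)
From HB Require Import structures.
From mathcomp Require Import all_boot all_order all_algebra.
From mathcomp Require Import all_classical all_reals all_analysis.
Set Implicit Arguments. Unset Strict Implicit. Unset Printing Implicit Defensive.
Import Order.TTheory GRing.Theory Num.Theory.
Import numFieldNormedType.Exports.
Local Open Scope classical_set_scope.
Local Open Scope ring_scope.

Section Market.
Context {R : realType} {d : measure_display} {Omega : measurableType d}.
Variable P : probability Omega R.
Variable Th : R.
Variable F : R -> set (set Omega).

Definition in_time (t : R) := 0 <= t <= Th.

Definition filtration :=
  (forall t, in_time t -> sigma_algebra setT (F t) /\ F t `<=` measurable) /\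
  (forall s t, 0 <= s -> s <= t -> t <= Th -> F s `<=` F t).

Definition usual_conditions :=
  (forall N, measurable N -> P N = 0%E -> forall A, A `<=` N -> F 0 A) /\
  (forall t, 0 <= t < Th ->
     F t = [set A | forall s, t < s <= Th -> F s A]).

Definition adapted (X : R -> Omega -> R) :=
  forall t, in_time t -> forall B : set R, measurable B -> F t (X t @^-1` B).

Definition cadlag (X : R -> Omega -> R) :=
  forall w,
    (forall t, 0 <= t < Th -> X s w @[s --> t^'+] --> X t w) /\
    (forall t, 0 < t <= Th -> cvg (X s w @[s --> t^'-])).

Definition martingale (M : R -> Omega -> R) :=
  adapted M /\
  (forall t, in_time t -> P.-integrable setT (fun w => (M t w)%:E)) /\
  (forall s t, 0 <= s -> s <= t -> t <= Th -> forall A, F s A ->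
     (\int[P]_(w in A) (M t w)%:E = \int[P]_(w in A) (M s w)%:E)%E).

Definition stopping_time (tau : Omega -> R) :=
  (forall w, in_time (tau w)) /\
  (forall t, in_time t -> F t [set w | tau w <= t]).

Definition stopped (M : R -> Omega -> R) (tau : Omega -> R) :=
  fun t w => M (Order.min t (tau w)) w.

Definition local_martingale (M : R -> Omega -> R) :=
  adapted M /\
  exists tau : nat -> Omega -> R,
    (forall n, stopping_time (tau n)) /\
    (forall n w, tau n w <= tau n.+1 w) /\
    {ae P, forall w, exists n, tau n w = Th} /\
    (forall n, martingale (stopped M (tau n))).

Definition consistent_price_system (lam : R) (S Z0 Z1 : R -> Omega -> R) :=
  (forall t, in_time t -> forall w, 0 < Z0 t w /\ 0 < Z1 t w) /\
  (forall w, Z0 0 w = 1) /\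
  martingale Z0 /\ local_martingale Z1 /\
  (forall t, in_time t ->
     {ae P, forall w, (1 - lam) * S t w <= Z1 t w / Z0 t w <= S t w}).

End Market.

Section Utility.
Context {R : realType}.
Implicit Types U : R -> R.

(* U is only relevant on (0, +oo) *)
Definition upper_semicontinuous_pos U :=
  forall x, 0 < x -> forall e, 0 < e -> exists2 del, 0 < del &
    forall y, 0 < y -> `|y - x| < del -> U y < U x + e.

Definition U_infty U : \bar R := lim ((fun x => (U x)%:E) @ +oo).

Definition utility U :=
  [/\ exists x y, [/\ 0 < x, 0 < y & U x != U y],
      (forall x y, 0 < x -> x <= y -> U x <= U y),
      upper_semicontinuous_pos U,
      (0 < U_infty U)%E &
      (fun x => U x / x) @ +oo --> 0].

(* U(0) := lim_{x -> 0+} U(x), which (U nondecreasing) is inf_{x>0} U(x) *)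
Definition U_zero U : \bar R := ereal_inf [set (U x)%:E | x in [set x | 0 < x]].

Definition Ubar U (x : R) : \bar R :=
  if 0 < x then (U x)%:E else if x == 0 then U_zero U else -oo%E.

Definition conjugate U (y : R) : \bar R :=
  ereal_sup [set (U x - x * y)%:E | x in [set x | 0 < x]].

Context {d : measure_display} {Omega : measurableType d}.
Variable P : probability Omega R.

Definition expected_utility U (f : Omega -> R) : \bar R :=
  if (\int[P]_w ((fun w => Ubar U (f w))^\-)%E w < +oo)%E
  then (\int[P]_w Ubar U (f w))%E else -oo%E.

Definition attainable (ZT : Omega -> R) (x : R) (f : Omega -> R) :=
  [/\ measurable_fun setT f, (forall w, 0 <= f w) &
      (\int[P]_w (ZT w * f w)%:E <= x%:E)%E].

Definition value_function (ZT : Omega -> R) (x : R) U : \bar R :=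
  ereal_sup [set expected_utility U f | f in attainable ZT x].

End Utility.

(* Main.v *)
(* Let rho be the density Z^0_T. A maximizing sequence f_n is treated separately
   on the union A of the atoms of P and on its atomless complement D. On each
   atom f_n is a.e. constant and bounded by the budget, so a diagonal argument
   gives a subsequence converging a.e. on A and along which the budget c spent
   on D converges. On D the constraint is put into a Lagrangian: pointwise
   maximizers X y of z |-> U z - y rho z are nonincreasing in y, and with
   y* = inf {y | E[rho X(y); D] <= c} the limits f- <= f+ of X y as y decreases,
   resp. increases, to y* are both pointwise optimal for y* and satisfy
   E[rho f-; D] <= c <= E[rho f+; D]. As D is atomless, Sierpinski's theorem
   yields a set on which to switch from f- to f+ so that exactly c is spent (if
   y* = 0, then f- is already optimal). Replacing f_n on D by this payoff costs
   asymptotically nothing and makes the sequence converge a.e.; if c = 0, then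
   a further subsequence of f_n tends to 0 on D anyway. Finally V(y rho) + y rho f_n - U(f_n)
   is nonnegative, and Fatou's lemma followed by y -> 0 shows that the limit is
   optimal. *)

Require Import Defs.
From HB Require Import structures.
From mathcomp Require Import all_boot all_order all_algebra.
From mathcomp Require Import all_classical all_reals all_analysis.
From mathcomp Require Import measurable_realfun lra.
Set Implicit Arguments. Unset Strict Implicit. Unset Printing Implicit Defensive.
Import Order.TTheory GRing.Theory Num.Theory.
Import numFieldNormedType.Exports.
Local Open Scope classical_set_scope.
Local Open Scope ring_scope.

(** * Pointwise maximizers of the Lagrangian *)

Lemma exists_vanishing_seq (R : realType) : exists k : nat -> R,
  [/\ forall n, 0 < k n <= 1, forall m n, (m <= n)%N -> k n <= k m,
      k @ \oo --> 0 & forall e, 0 < e -> exists N, forall n, (N <= n)%N -> k n < e].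
Proof.
exists (fun n => n.+1%:R^-1); split.
- by move=> n; rewrite invr_gt0 ltr0n/= invf_le1// ler1n.
- by move=> m n mn; rewrite lef_pV2 ?posrE ?ltr0n// ler_nat.
- exact: cvg_harmonic.
- move=> e e0; have [N _ hN] := near_infty_natSinv_lt (PosNum e0).
  by exists N => n Nn; exact: hN.
Qed.

Section Pointwise.
Context {R : realType}.
Implicit Types (U : R -> R) (q x y z : R).

Lemma UbarE U x : 0 < x -> Ubar U x = (U x)%:E.
Proof. by rewrite /Ubar => ->. Qed.

Lemma Ubar0 U : Ubar U 0 = U_zero U.
Proof. by rewrite /Ubar ltxx eqxx. Qed.

Lemma Ubar_lty U x : (Ubar U x < +oo)%E.
Proof.
rewrite /Ubar; case: ifP => _; first exact: ltry.
case: ifP => // _; apply: le_lt_trans (ltry (U 1)).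
by apply: ereal_inf_lbound; exists 1 => //=; exact: ltr01.
Qed.

Lemma le_Ubar U x y : utility U -> x <= y -> (Ubar U x <= Ubar U y)%E.
Proof.
move=> [_ mU _ _ _] xy; have [x0|x0|x0] := ltrgtP x 0.
- by rewrite {1}/Ubar ltNge (ltW x0)/= lt_eqF// leNye.
- by rewrite !UbarE ?lee_fin ?mU// (lt_le_trans x0).
- subst x; rewrite Ubar0; have [->|y0] := eqVneq y 0; first by rewrite Ubar0.
  have y1 : 0 < y by rewrite lt_neqAle eq_sym y0.
  by rewrite UbarE//; apply: ereal_inf_lbound; exists y.
Qed.

(** Since [Ubar U] is nondecreasing, a strict bound at the single point [x + e] controls it
    everywhere to the left of that point. At 0 the bound comes from [U_zero] being an infimum, not
    from semicontinuity. *)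
Lemma Ubar_usc U x (r : \bar R) : utility U -> (Ubar U x < r)%E ->
  exists2 e, 0 < e & (Ubar U (x + e) < r)%E.
Proof.
move=> HU; have [_ _ uscU _ _] := HU; have [x0|x0|->] := ltrgtP x 0.
- move=> ?; exists (- x / 2); first lra.
  have h : x + - x / 2 < 0 by lra.
  apply: le_lt_trans (_ : (-oo < r)%E); first by rewrite /Ubar ltNge (ltW h)/= lt_eqF.
  by apply: le_lt_trans; [exact: leNye|eassumption].
- rewrite UbarE//; case: r => [r||//]; last first.
    by move=> _; exists 1 => //; exact: Ubar_lty.
  rewrite lte_fin => Ur; have e0 : 0 < r - U x by lra.
  have [del d0 /(_ (x + del / 2)) h] := uscU x x0 _ e0.
  exists (del / 2); first lra.
  rewrite UbarE ?lte_fin; last lra.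
  rewrite (_ : r = U x + (r - U x)); last lra.
  apply: h; first lra.
  by rewrite addrAC subrr add0r gtr0_norm; lra.
- rewrite Ubar0 => /ereal_inf_lt[_ /= [e e0 <-] er].
  by exists e => //; rewrite add0r UbarE.
Qed.

Lemma measurable_Ubar U : utility U -> measurable_fun setT (Ubar U).
Proof.
move=> HU mD; apply: (measurability _ (ErealGenOInfty.measurableE R)) => //.
move=> _ [_ [r ->] <-]; rewrite setTI; apply: is_interval_measurable => s t/=.
rewrite !in_itv/= !andbT => hs ht u /andP[su ut].
by rewrite in_itv/= andbT (lt_le_trans hs)// le_Ubar.
Qed.

Lemma conjugate_ge U q x : 0 < x -> ((U x - x * q)%:E <= conjugate U q)%E.
Proof. by move=> x0; apply: ereal_sup_ubound; exists x. Qed.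

Lemma conjugate_fin_num U q : utility U -> 0 < q -> conjugate U q \is a fin_num.
Proof.
move=> HU q0; have [_ mU _ _ grU] := HU.
rewrite fin_numElt; apply/andP; split.
  have h : ((U 1 - 1 * q)%:E <= conjugate U q)%E by apply: conjugate_ge; exact: ltr01.
  by rewrite (lt_le_trans _ h)// ltNyr.
(* Beyond [M] the growth condition gives [U x <= q * x], so the terms of the supremum are at most 0;
   up to [K > M] monotonicity bounds them by [U K]. *)
have /cvgrPdist_lt/(_ q q0)[M [_ hM]] := grU.
pose K := Num.max M 0 + 1.
have m0 : 0 <= Num.max M 0 by rewrite le_max lexx orbT.
have mM : M <= Num.max M 0 by rewrite le_max lexx.
have K0 : 0 < K by rewrite /K; lra.
have MK : M < K by rewrite /K; lra.
apply: le_lt_trans (ltry (Num.max (U K) 0)).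
apply: ge_ereal_sup => _ [x /= x0 <-]; rewrite lee_fin le_max.
have [xK|Kx] := leP x K.
  by apply/orP; left; have := mU _ _ x0 xK; have := mulr_gt0 x0 q0; lra.
apply/orP; right; have := hM x (lt_trans MK Kx).
rewrite sub0r normrN => /ltW/(le_trans (ler_norm _)).
by rewrite ler_pdivrMr// mulrC; lra.
Qed.

Lemma Ubar_le_conjugate U q z : utility U -> 0 < q -> 0 <= z ->
  (Ubar U z <= (fine (conjugate U q) + q * z)%:E)%E.
Proof.
move=> HU q0; rewrite EFinD fineK ?conjugate_fin_num// le_eqVlt.
move=> /predU1P[<-|z0]; last first.
  rewrite UbarE// mulrC -leeBlDr// -EFinB; exact: conjugate_ge.
rewrite mulr0 adde0 Ubar0; apply/lee_addgt0Pr => e e0.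
have eq0 : 0 < e / q by exact: divr_gt0.
(* At [z = 0], [U_zero U] is bounded by the value of [U] at [e / q], where the linear term is just
   [e]. *)
apply: (@le_trans _ _ (U (e / q))%:E); first by apply: ereal_inf_lbound; exists (e / q).
by rewrite -leeBlDr//; have := conjugate_ge U q eq0; rewrite divfK ?gt_eqF.
Qed.

Lemma conjugate_nonincr U q r : 0 < q -> q <= r -> (conjugate U r <= conjugate U q)%E.
Proof.
move=> q0 qr; apply: ge_ereal_sup => _ [x /= x0 <-].
apply: (le_trans _ (conjugate_ge U q x0)).
by rewrite lee_fin lerB// ler_wpM2l// ltW.
Qed.

(* x maximizes z |-> U z - q z; the terms are arranged so that U z = -oo is harmless. *)
Definition maximizer U q x :=
  0 <= x /\ forall z, 0 <= z -> (Ubar U z + (q * (x - z))%:E <= Ubar U x)%E.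

Lemma Ubar_maximizer_fin U q x : maximizer U q x -> Ubar U x \is a fin_num.
Proof.
move=> [x0 /(_ 1 ler01)]; rewrite UbarE// => h.
by rewrite fin_numElt Ubar_lty andbT (lt_le_trans _ h)// ltNyr.
Qed.

(** Adding the two optimality inequalities, each tested at the other maximizer, cancels the finite
    utilities and leaves [(r - q) * (y - x) <= 0]. *)
Lemma maximizer_antimono U q r x y : q < r ->
  maximizer U q x -> maximizer U r y -> y <= x.
Proof.
move=> qr mx my; have [x0 /(_ y my.1)] := mx; have [y0 /(_ x x0)] := my.
rewrite -(fineK (Ubar_maximizer_fin mx)) -(fineK (Ubar_maximizer_fin my)).
rewrite -!EFinD !lee_fin => h1 h2.
have : (r - q) * (y - x) <= 0 by lra.
by rewrite pmulr_rle0 ?subr_gt0// subr_le0.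
Qed.

(** Upper semicontinuity closes the graph of the argmax. The limit slope [q] may be 0, which is the
    case of a vanishing multiplier. *)
Lemma maximizer_cvg U (q_ x_ : nat -> R) q x : utility U ->
  (forall n, maximizer U (q_ n) (x_ n)) ->
  q_ @ \oo --> q -> x_ @ \oo --> x -> maximizer U q x.
Proof.
move=> HU mx qc xc; split.
  by apply: (ler_cvg_to (cvg_cst 0) xc); apply: nearW => n; exact: (mx n).1.
move=> z z0; rewrite leNgt; apply/negP => Uxz.
have Uz : Ubar U z \is a fin_num.
  rewrite fin_numElt Ubar_lty andbT ltNge leeNy_eq; apply/negP => /eqP Uz.
  by move: Uxz; rewrite Uz addNye ltNge leNye.
move: Uxz; rewrite -(fineK Uz) -EFinD; set u := fine _ => Uxz.
(* If [z] beats [x], the strict inequality survives at [x + e]. Eventually [x_ n <= x + e], and the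
   limit of the optimality inequalities of [x_ n] contradicts it. *)
have [e e0 Uxe] := Ubar_usc HU Uxz.
have near_e : \forall n \near \oo, ((u + q_ n * (x_ n - z))%:E <= Ubar U (x + e))%E.
  have /cvgrPdist_lt/(_ e e0) := xc; apply: filterS => n xn.
  have := (mx n).2 z z0; rewrite -(fineK Uz) -EFinD => /le_trans; apply.
  by apply: le_Ubar => //; move: xn; rewrite distrC ltr_distl; lra.
have fe : Ubar U (x + e) \is a fin_num.
  have [n /= hn] := filter_ex near_e.
  by rewrite fin_numElt Ubar_lty andbT (lt_le_trans _ hn)// ltNyr.
move: Uxe; apply/negP; rewrite -leNgt -(fineK fe) lee_fin.
have c1 : (fun n => u + q_ n * (x_ n - z)) @ \oo --> u + q * (x - z).
  by apply: cvgD; [exact: cvg_cst|apply: cvgM => //; apply: cvgB => //; exact: cvg_cst].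
apply: (ler_cvg_to c1 (cvg_cst _)).
by move: near_e; apply: filterS => n; rewrite -(fineK fe) lee_fin.
Qed.

Lemma bounded_cluster (u : nat -> R) (a b : R) : (forall n, a <= u n <= b) ->
  exists2 x, a <= x <= b & forall e N, 0 < e -> exists2 n, (N <= n)%N & `|u n - x| < e.
Proof.
move=> uab; have Fab : (u @ \oo) `[a, b]%classic.
  by exists 0%N => // n _ /=; rewrite in_itv/=.
have [x [xab clx]] := @segment_compact R a b (u @ \oo) _ Fab.
exists x; first by move: xab; rewrite /= in_itv.
move=> e N e0.
have /clx/(_ (nbhsx_ballx x e e0))[y [/= [n Nn <-]]] : (u @ \oo) (u @` [set n | (N <= n)%N]).
  by exists N => // n /= Nn; exists n.
by rewrite /ball/= distrC; exists n.
Qed.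

(** A maximizing sequence stays bounded because the conjugate is also finite at the smaller slope
    [q / 2]; a cluster point is optimal by upper semicontinuity. *)
Lemma maximizer_exists U q : utility U -> 0 < q -> exists x, maximizer U q x.
Proof.
move=> HU q0.
have [k [k01 _ _ kc]] := exists_vanishing_seq R.
pose V r := fine (conjugate U r).
have h n : exists z, 0 < z /\ V q - k n < U z - z * q.
  have : ((V q - k n)%:E < conjugate U q)%E.
    rewrite -(fineK (conjugate_fin_num HU q0)) lte_fin ltrBlDr ltrDl.
    by case/andP: (k01 n).
  by move=> /ereal_sup_gt[_ [z /= z0 <-]]; rewrite lte_fin; exists z.
have [z_ hz] := choice h.
(* [M] results from [U z <= V (q / 2) + z * q / 2] and [V q - 1 < U z - z * q], which together bound
   [z * q / 2]. *)
pose M := 2 / q * (V (q / 2) - V q + 1).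
have zM n : 0 <= z_ n <= M.
  have [z0 zV] := hz n; rewrite ltW//=.
  have q20 : 0 < q / 2 by lra.
  have := conjugate_ge U (q / 2) z0.
  rewrite -(fineK (conjugate_fin_num HU q20)) lee_fin -/(V _) => Vz.
  have /andP[_] := k01 n.
  rewrite /M mulrAC ler_pdivlMr// => n1.
  by move: n1 Vz zV; rewrite mulrA; set p := z_ n * q; lra.
have [x /andP[x0 _] clx] := bounded_cluster zM.
exists x; split => // z z0.
suff : ((V q + q * x)%:E <= Ubar U x)%E.
  apply: le_trans; apply: le_trans (leeD2r _ (Ubar_le_conjugate HU q0 z0)) _.
  by rewrite -EFinD lee_fin -/(V q); lra.
rewrite leNgt; apply/negP => /(Ubar_usc HU)[e e0].
have lb n : `|z_ n - x| < e -> ((V q - k n + z_ n * q)%:E <= Ubar U (x + e))%E.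
  move=> zx; have [zn0 zV] := hz n.
  apply: (@le_trans _ _ (Ubar U (z_ n))); first by rewrite UbarE// lee_fin; lra.
  by apply: le_Ubar => //; move: zx; rewrite ltr_distl; lra.
have fe : Ubar U (x + e) \is a fin_num.
  have [n _ /lb hn] := clx _ 0%N e0.
  by rewrite fin_numElt Ubar_lty andbT (lt_le_trans _ hn)// ltNyr.
rewrite -(fineK fe) lte_fin => Vw; move: lb; rewrite -(fineK fe).
set w := fine _ in Vw * => lb.
(* [eta] bounds both errors, [k n] and [x - z_ n]; together they cost at most [eta * (1 + q)], half
   of the gap [V q + q * x - w]. *)
pose eta := (V q + q * x - w) / (2 * (1 + q)).
have q1 : 0 < 2 * (1 + q) by lra.
have eta0 : 0 < eta by apply: divr_gt0 => //; lra.
have [N hN] := kc _ eta0.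
have [|n Nn] := clx (Num.min e eta) N; first by rewrite lt_min e0.
rewrite lt_min => /andP[/lb + ze].
rewrite lee_fin => hn.
have nN := hN n Nn.
have etaE : eta * (2 * (1 + q)) = V q + q * x - w by rewrite /eta divfK// gt_eqF.
have : (x - z_ n) * q <= eta * q.
  by rewrite ler_pM2r//; move: ze; rewrite ltr_distl; lra.
by lra.
Qed.

End Pointwise.

(** * Atoms and atomless sets *)

(** The limit superior, passed through [fine] and the absolute value, is real, nonnegative and
    measurable everywhere, and equals the limit wherever a finite one exists. *)
Lemma measurable_pointwise_limit d (T : measurableType d) (R : realType)
    (g_ : nat -> T -> R) : (forall n, measurable_fun setT (g_ n)) ->
  (forall n w, 0 <= g_ n w) ->
  exists g : T -> R, [/\ measurable_fun setT g, forall w, 0 <= g w &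
    forall w l, g_ ^~ w @ \oo --> l -> g w = l].
Proof.
move=> mg g0; exists (fun w => `|fine (limn_esup (fun n => (g_ n w)%:E))|); split => //.
- apply: measurableT_comp => //; apply: measurableT_comp => //.
  by apply: measurable_fun_limn_esup => n; exact/measurable_EFinP.
- move=> w l gl.
  have gl' : (fun n => (g_ n w)%:E) @ \oo --> l%:E.
    by apply/fine_cvgP; split => //; apply: nearW.
  rewrite (cvg_limn_einf_sup gl').2/= ger0_norm//.
  by apply: (ler_cvg_to (cvg_cst 0) gl); exact: nearW.
Qed.

Section Nonatomic.
Context d (T : measurableType d) (R : realType) (mu : {measure set T -> \bar R}).

Definition nonatomic (D : set T) := forall B, measurable B -> B `<=` D ->
  (0 < mu B)%E -> exists C, [/\ measurable C, C `<=` B, (0 < mu C)%E & (mu C < mu B)%E].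

Hypothesis mufin : (mu setT < +oo)%E.
Let m B := fine (mu B).

Let mE B : measurable B -> mu B = (m B)%:E.
Proof.
move=> mB; rewrite fineK// ge0_fin_numE// (le_lt_trans _ mufin)//.
by apply: le_measure; rewrite ?inE.
Qed.

Let m_ge0 B : 0 <= m B. Proof. exact: fine_ge0. Qed.

Let mU A B : measurable A -> measurable B -> A `&` B = set0 ->
  m (A `|` B) = m A + m B.
Proof.
move=> mA mB AB; apply: EFin_inj; rewrite EFinD -!mE//; first exact: measureU.
exact: measurableU.
Qed.

Let mD A B : measurable A -> measurable B -> B `<=` A -> m A = m B + m (A `\` B).
Proof.
move=> mA mB BA; rewrite -mU ?setDUK//; first exact: measurableD.
by rewrite setDE setICA setICr setI0.
Qed.

Let m_le A B : measurable A -> measurable B -> A `<=` B -> m A <= m B.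
Proof. by move=> mA mB AB; rewrite (mD mB mA AB) lerDl. Qed.

(** Repeated halving: if [E] is a piece of [C] of positive and strictly smaller measure, one of [E]
    and its complement in [C] has at most half of the measure of [C]. *)
Lemma nonatomic_small D (e : R) B : nonatomic D -> 0 < e ->
  measurable B -> B `<=` D -> 0 < m B ->
  exists C, [/\ measurable C, C `<=` B, 0 < m C & m C <= e].
Proof.
move=> naD e0 mB BD B0.
have it n : exists C, [/\ measurable C, C `<=` B, 0 < m C & m C <= m B / 2 ^+ n].
  elim: n => [|n [C [mC CB C0 Cn]]]; first by exists B; rewrite expr0 divr1; split.
  have : (0 < mu C)%E by rewrite mE.
  move=> /(naD C mC (subset_trans CB BD))[E [mEs EC]].
  rewrite !mE// !lte_fin => E0 EC'.
  have := mD mC mEs EC; have mCE := measurableD mC mEs.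
  rewrite exprSr invfM mulrA => CE.
  have [h|h] := leP (m E) (m C / 2).
    by exists E; split => //; [exact: subset_trans CB|lra].
  exists (C `\` E); split => //; [by apply: subset_trans CB => x []|lra|lra].
have [n hn] : exists n : nat, m B / e < n%:R.
  by exists (Num.bound (m B / e)); apply: archi_boundP; rewrite divr_ge0// ltW.
have [C [mC CB C0 Cn]] := it n; exists C; split => //.
apply: (le_trans Cn); rewrite ler_pdivrMr ?exprn_gt0// mulrC -ler_pdivrMr//.
apply: (le_trans (ltW hn)); rewrite -natrX ler_nat.
by apply: ltnW; exact: ltn_expl.
Qed.

(* Greedy exhaustion: each step adds a set at least half as large as the
   largest one that still fits. *)
Lemma nonatomic_intermediate D t : measurable D -> nonatomic D ->
  0 <= t <= m D -> exists B, [/\ measurable B, B `<=` D & m B = t].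
Proof.
move=> mDD naD /andP[t0 tD].
pose adm B C := [/\ measurable C, C `<=` D `\` B & m B + m C <= t].
(* The guard [m B <= t] makes the choice function [G] total; sets that are already too large get a
   junk value. *)
have hG B : exists C, m B <= t -> adm B C /\ forall C', adm B C' -> m C' <= 2 * m C.
  have [Bt|Bt] := leP (m B) t; last by exists set0.
  pose E := [set m C | C in adm B].
  have E0 : E (m set0).
    by exists set0 => //; split => //; rewrite /m measure0/= addr0.
  have ubE : has_ubound E by exists t => _ [C [_ _ h] <-]; have := m_ge0 B; lra.
  have supE : has_sup E by split => //; exists (m set0).
  have [s0|s0] := leP (sup E) 0.
    exists set0 => _; split; first by split => //; rewrite /m measure0/= addr0.
    move=> C' C'B; apply: (@le_trans _ _ (sup E)).
      by apply: ub_le_sup => //; exists C'.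
    by rewrite (le_trans s0)// mulr_ge0.
  have s2 : 0 < sup E / 2 by lra.
  have [_ [C CB <-] hC] := sup_adherent s2 supE.
  exists C => _; split => // C' C'B.
  have : m C' <= sup E by apply: ub_le_sup => //; exists C'.
  lra.
have [G hGG] := choice hG.
pose B_ := fix B_ n := if n is k.+1 then B_ k `|` G (B_ k) else set0.
have inv n : [/\ measurable (B_ n), B_ n `<=` D & m (B_ n) <= t].
  elim: n => [|n [mB BD Bt]]; first by split => //=; rewrite /m measure0.
  have [[mG GD Gt] _] := hGG _ Bt.
  split => /=; [exact: measurableU|by rewrite subUset; split => // x /GD[]|].
  rewrite mU//; rewrite -subset0 => x [Bx /GD[]]; exact.
have BS n : m (B_ n.+1) = m (B_ n) + m (G (B_ n)).
  have [mB BD Bt] := inv n; have [[mG GD Gt] _] := hGG _ Bt.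
  by rewrite /= mU// -subset0 => x [Bx /GD[]]; exact.
pose B := \bigcup_n B_ n.
have mB : measurable B by apply: bigcup_measurable => n _; have [] := inv n.
have BD : B `<=` D by apply: bigcup_sub => n _; have [] := inv n.
have Bn n : m (B_ n) <= m B.
  by apply: m_le => //; [have [] := inv n|exact: bigcup_sup].
have Bt : m B <= t.
  have ndB : nondecreasing_seq B_.
    by apply/nondecreasing_seqP => n; rewrite subsetEset; exact: subsetUl.
  have mBn n : measurable (B_ n) by have [] := inv n.
  have /fine_cvgP[_ cB] : mu \o B_ @ \oo --> (m B)%:E.
    by rewrite -mE//; exact: nondecreasing_cvg_mu.
  by apply: (ler_cvg_to cB (cvg_cst t)); apply: nearW => n /=; have [] := inv n.
(* If [m B < t], a piece [C] of the remainder with [m C <= t - m B] fits at every stage, so each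
   greedy step gains at least [m C / 2] and [m (B_ n)] eventually exceeds [t]. *)
exists B; split => //; apply/eqP; rewrite eq_le Bt/= leNgt; apply/negP => Blt.
have mDB : measurable (D `\` B) by exact: measurableD.
have tB : 0 < t - m B by lra.
have DB0 : 0 < m (D `\` B) by have := mD mDD mB BD; lra.
have [C [mC CDB C0 Ct]] := nonatomic_small naD tB mDB (@subDsetl _ _ _) DB0.
have CG n : m C / 2 <= m (G (B_ n)).
  have [_ _ Bnt] := inv n; have [_ /(_ C)] := hGG _ Bnt.
  suff : adm (B_ n) C by move=> /[swap] /[apply]; lra.
  split => //; last by have := Bn n; lra.
  by move=> x /CDB[Dx nBx]; split => // Bx; apply: nBx; exists n.
have lbB n : n%:R * (m C / 2) <= m (B_ n).
  elim: n => [|n IH]; first by rewrite mul0r.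
  by rewrite BS -natr1 mulrDl mul1r lerD.
have C2 : 0 < m C / 2 by lra.
pose n := Num.bound (t / (m C / 2)).
have : t / (m C / 2) < n%:R by apply: archi_boundP; rewrite divr_ge0// ltW.
rewrite ltr_pdivrMr// ltNge => /negP; apply.
by apply: le_trans (lbB n) _; have [] := inv n.
Qed.

Definition atom A := [/\ measurable A, (0 < mu A)%E &
  forall C, measurable C -> C `<=` A -> mu C = 0%E \/ mu C = mu A].

(** Countable families of atoms can be merged, so some family attains the supremum of the measures
    of their unions. An unsplittable set of positive measure outside it would be one more atom and
    exceed the supremum. Empty members allow for finitely many atoms. *)
Lemma atomic_decomposition : exists A_ : nat -> set T,
  (forall i, A_ i = set0 \/ atom (A_ i)) /\ nonatomic (~` \bigcup_i A_ i).
Proof.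
pose adm (A_ : nat -> set T) := forall i, A_ i = set0 \/ atom (A_ i).
have mA A_ : adm A_ -> measurable (\bigcup_i A_ i).
  by move=> aA; apply: bigcup_measurable => i _; have [->|[]] := aA i.
pose E := [set m (\bigcup_i A_ i) | A_ in adm].
have ubE : has_ubound E.
  by exists (m setT) => _ [A_ aA <-]; apply: m_le => //; exact: mA.
have supE : has_sup E.
  by split => //; exists (m (\bigcup_(i : nat) set0)), (fun=> set0) => // i; left.
have [k [k01 _ _ kc]] := exists_vanishing_seq R.
have hn n : exists A_, adm A_ /\ sup E - k n < m (\bigcup_i A_ i).
  have /andP[n0 _] := k01 n.
  by have [_ [A_ aA <-] h] := sup_adherent n0 supE; exists A_.
have [F hF] := choice hn.
(* Coding pairs of indices by [pickle] merges the near-optimal families [F i] into one sequence. *)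
pose A_ l := if unpickle l is Some (i, j) then F i j else set0.
have aA : adm A_.
  move=> l; rewrite /A_; case: unpickle => [[i j]|]; last by left.
  exact: (hF i).1.
have supA : sup E <= m (\bigcup_i A_ i).
  apply/ler_addgt0Pr => e e0.
  have [n /(_ _ (leqnn _)) hne] := kc _ e0.
  have [aF hFn] := hF n.
  suff : m (\bigcup_i F n i) <= m (\bigcup_i A_ i) by lra.
  apply: m_le; [exact: mA|exact: mA|].
  move=> x [j _ Fx]; exists (pickle (n, j)) => //.
  by rewrite /A_ pickleK.
exists A_; split => // B mB BA B0; apply: contrapT => noC.
have aB : atom B.
  split => // C mC CB; apply: contrapT => /not_orP[/eqP C0 /eqP CneB].
  apply: noC; exists C; split => //; first by rewrite lt0e C0 measure_ge0.
  by rewrite lt_neqAle CneB/= le_measure// inE.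
pose A' i := if i is j.+1 then A_ j else B.
have aA' : adm A' by case => [|j] /=; [right|].
have : m (\bigcup_i A' i) <= sup E by apply: ub_le_sup => //; exists A'.
apply/negP; rewrite -ltNge.
have -> : \bigcup_i A' i = B `|` \bigcup_i A_ i.
  apply/seteqP; split => [x [[|j] _ ?]|x [Bx|[j _ ?]]];
    [by left|by right; exists j|by exists 0%N|by exists j.+1].
rewrite mU//; [|exact: mA|by apply/disjoints_subset].
by move: B0; rewrite mE// lte_fin; lra.
Qed.

(** Each sublevel set of [f] within the atom is null or full; the constant is the supremum of the
    levels at which it is null. *)
Lemma ae_constant_on_atom A (f : T -> R) : atom A -> measurable_fun setT f ->
  (forall w, 0 <= f w) ->
  exists2 v, 0 <= v & {ae mu, forall w, A w -> f w = v}.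
Proof.
move=> [mA A0 atA] mf f0.
pose L r := A `&` [set w | f w < r].
have mL r : measurable (L r).
  apply: measurableI => //; rewrite -[X in measurable X]setTI.
  have := mf measurableT `]-oo, r[%classic (measurable_itv _).
  by congr (measurable _); apply/seteqP; split => x /=; rewrite in_itv.
have L_dich r : mu (L r) = 0%E \/ mu (L r) = mu A by apply: atA => // x [].
have L_le r s : r <= s -> (mu (L r) <= mu (L s))%E.
  move=> rs; rewrite le_measure ?inE// => x [Ax /= fx]; split => //=.
  exact: lt_le_trans fx rs.
pose S := [set r | mu (L r) = 0%E].
have S0 : S 0.
  rewrite /S/= (_ : L 0 = set0) ?measure0//; rewrite -subset0 => x [_ /=].
  by rewrite ltNge f0.
(* Were every integer level null, [A] would be a countable union of null sets. A full level bounds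
   [S] from above. *)
have [n0 hn0] : exists n : nat, mu (L n%:R) = mu A.
  apply: contrapT => /forallNP h.
  have : mu.-negligible (\bigcup_n L n%:R).
    apply: negligible_bigcup => n; apply/negligibleP => //.
    by have [//|/h] := L_dich n%:R.
  rewrite (_ : \bigcup_n L n%:R = A); last first.
    apply/seteqP; split => [x [n _ []]//|x Ax].
    by exists (Num.bound (f x)) => //; split => //=; exact: archi_boundP.
  by move=> /negligibleP => /(_ mA) A00; move: A0; rewrite A00 ltxx.
have ubS : has_ubound S.
  exists n0%:R => r /= Sr; rewrite leNgt; apply/negP => /ltW/L_le.
  by rewrite hn0 Sr leNgt A0.
have supS : has_sup S by split => //; exists 0.
have [k [k01 _ _ kc]] := exists_vanishing_seq R.
exists (sup S); first exact: ub_le_sup.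
(* Points where [f] differs from [sup S] lie in a sublevel set just below it or outside one just
   above it; countably many null sets cover them. *)
apply: (@negligibleS _ _ _ _ (\bigcup_n L (sup S - k n) `|` \bigcup_n (A `\` L (sup S + k n)))).
  move=> w /= /not_implyP[Aw /eqP]; rewrite neq_lt => /orP[fw|fw].
    left; have [|N /(_ _ (leqnn _)) hN] := kc (sup S - f w); first by rewrite subr_gt0.
    by exists N => //; split => //=; lra.
  right; have [|N /(_ _ (leqnn _)) hN] := kc (f w - sup S); first by rewrite subr_gt0.
  by exists N => //; split => // -[_ /=]; lra.
apply: negligibleU; apply: negligible_bigcup => n; have /andP[kn0 _] := k01 n.
  apply/negligibleP => //; have [r Sr rS] := sup_adherent kn0 supS.
  by apply/eqP; rewrite eq_le measure_ge0 andbT -Sr; apply: L_le; exact: ltW.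
have mAL : measurable (A `\` L (sup S + k n)) by exact: measurableD.
apply/negligibleP => //.
have [h|h] := L_dich (sup S + k n).
  by have := ub_le_sup ubS h; rewrite gerDl leNgt kn0.
have LA : L (sup S + k n) `<=` A by move=> x [].
have := mD mA (mL _) LA; rewrite {1 2}/m h => /eqP.
rewrite -subr_eq0 opprD addrA subrr sub0r oppr_eq0 => /eqP m0.
by have := mE mAL; rewrite m0.
Qed.

End Nonatomic.

(** * Measures given by a density, and Sierpinski's theorem for them *)

Section Density.
Context d (T : measurableType d) (R : realType) (mu : {measure set T -> \bar R}).
Context (f : T -> \bar R) (mf : measurable_fun setT f) (f0 : forall w, (0 <= f w)%E).

(** The two anonymous proof arguments record measurability and nonnegativity in the term itself, so
    that the measure structure can be attached to it. *)
Definition density of measurable_fun setT f & (forall w, 0 <= f w)%E :=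
  fun A => (\int[mu]_(w in A) f w)%E.

Local Notation nu := (density mf f0).

Let nu0 : nu set0 = 0%E. Proof. exact: integral_set0. Qed.

Let nu_ge0 A : (0 <= nu A)%E. Proof. exact: integral_ge0. Qed.

Let nu_sigma : semi_sigma_additive nu.
Proof. exact: semi_sigma_additive_nng_induced. Qed.

HB.instance Definition _ := isMeasure.Build d T R nu nu0 nu_ge0 nu_sigma.

Lemma density_gt0 A : measurable A -> (forall w, A w -> 0 < f w)%E ->
  (0 < mu A)%E -> (0 < nu A)%E.
Proof.
move=> mA fA muA; rewrite lt0e nu_ge0 andbT; apply/eqP => nuA.
have mfA : measurable_fun A f by exact: measurable_funTS.
have : (\int[mu]_(w in A) `|f w|)%E = 0%E.
  by rewrite -[RHS]nuA; apply: eq_integral => w _; rewrite gee0_abs.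
move=> /(ae_eq_integral_abs _ mA mfA)[N [mN N0 fN]].
move: muA; rewrite lt0e => /andP[/eqP + _]; apply; apply/eqP.
rewrite eq_le measure_ge0 andbT -N0 le_measure ?inE// => w Aw.
apply: fN => /= /(_ Aw) fw0; move: (fA w Aw); rewrite fw0.
by rewrite ltxx.
Qed.

(** Where [f] vanishes [nu] has no mass, so only the part [B'] of [B] with [f > 0] matters.
    Splitting [B'] under [mu] gives two pieces of positive [mu]-measure, hence of positive
    [nu]-measure. *)
Lemma nonatomic_density D : measurable D -> nonatomic mu D ->
  (nu D < +oo)%E -> nonatomic nu D.
Proof.
move=> mD naD nuD B mB BD nuB.
pose B' := B `&` [set w | (0 < f w)%E].
have mB' : measurable B' by exact: (emeasurable_fun_o_infty mB (measurable_funTS mf)).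
have mBB' : measurable (B `\` B') by exact: measurableD.
have B'B : B' `<=` B by move=> x [].
have nuBB' : nu (B `\` B') = 0%E.
  apply: integral0_eq => w [Bw nB']; apply/eqP; rewrite eq_le f0 andbT leNgt.
  by apply/negP => fw; exact: nB'.
have nuD' A C : measurable A -> measurable C -> C `<=` A ->
    (nu A = nu C + nu (A `\` C))%E.
  move=> mA mC CA; rewrite -measureU; [|exact: mC|exact: measurableD|].
    by rewrite setDUK.
  by rewrite setDE setICA setICr setI0.
have muB' : (0 < mu B')%E.
  rewrite lt0e measure_ge0 andbT; apply/eqP => muB'.
  have : (0 < nu B)%E := nuB; rewrite (nuD' _ _ mB mB' B'B) nuBB' adde0.
  by rewrite /density null_set_integral ?ltxx//; exact: measurable_funTS.
have [C [mC CB' muC0 muC]] := naD B' mB' (subset_trans B'B BD) muB'.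
have CB := subset_trans CB' B'B.
have fin A : measurable A -> A `<=` D -> nu A \is a fin_num.
  move=> mA AD; rewrite ge0_fin_numE//; apply: le_lt_trans nuD.
  by apply: le_measure; rewrite ?inE.
exists C; split => //; first by apply: density_gt0 => // w /CB'[].
have -> : (nu C < nu B)%E = (nu C < nu C + nu (B `\` C))%E by rewrite -nuD'.
rewrite lteDl ?fin//; last exact: subset_trans CB BD.
have mB'C : measurable (B' `\` C) by exact: measurableD.
apply: (@lt_le_trans _ _ (nu (B' `\` C))).
  apply: density_gt0 => //; first by move=> w [[]].
  rewrite lt0e measure_ge0 andbT; apply/eqP => h.
  move: muC; apply/negP; rewrite -leNgt -(setDUK CB').
  apply: (le_trans (measureU2 mu mC mB'C)).
  by rewrite [X in (_ + X <= _)%E](_ : _ = 0%E) ?adde0.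
apply: le_measure; rewrite ?inE//; first exact: measurableD.
by move=> x [/B'B].
Qed.

(** [nonatomic_intermediate] wants a finite total mass, whereas [nu] is known to be finite on [D]
    only; hence the restriction of [nu] to [D]. *)
Lemma integral_intermediate D t : measurable D -> nonatomic mu D ->
  (\int[mu]_(w in D) f w < +oo)%E -> (0 <= t%:E <= \int[mu]_(w in D) f w)%E ->
  exists B, [/\ measurable B, B `<=` D & (\int[mu]_(w in B) f w = t%:E)%E].
Proof.
move=> mD naD fD tD.
have E A : A `<=` D -> mrestr nu mD A = nu A by move=> AD; rewrite /mrestr setIidl.
have naD' : nonatomic (mrestr nu mD) D.
  move=> B mB BD nuB; have nuB' : (0 < nu B)%E by rewrite -E.
  have [C [mC CB]] := nonatomic_density mD naD fD mB BD nuB'.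
  have := E _ (subset_trans CB BD) => /esym/= -> C0 CltB.
  by exists C; split => //; have := E _ BD => /= ->.
have fin : (mrestr nu mD setT < +oo)%E by rewrite /mrestr setTI.
have tD' : 0 <= t <= fine (mrestr nu mD D).
  have finD : (\int[mu]_(w in D) f w)%E \is a fin_num.
    by rewrite ge0_fin_numE// integral_ge0.
  move: tD; rewrite -(fineK finD) !lee_fin.
  by have -> : fine (mrestr nu mD D) = fine (nu D) by rewrite E.
have [B [mB BD]] := nonatomic_intermediate fin mD naD' tD'.
have -> : fine (mrestr nu mD B) = fine (nu B) by rewrite E.
move=> Bt; exists B; split => //; rewrite -Bt fineK// ge0_fin_numE//.
have BD' : (nu B <= nu D)%E by apply: le_measure; rewrite ?inE.
exact: le_lt_trans BD' fD.
Qed.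

End Density.

Lemma ae_cvg0_of_summable d (T : measurableType d) (R : realType)
    (mu : {measure set T -> \bar R}) D (h_ : nat -> T -> R) : measurable D ->
  (forall n, measurable_fun D (h_ n)) -> (forall n w, 0 <= h_ n w) ->
  (forall n, (\int[mu]_(w in D) (h_ n w)%:E <= (1 / (2 ^ n.+1)%:R)%:E)%E) ->
  {ae mu, forall w, D w -> h_ ^~ w @ \oo --> 0}.
Proof.
move=> mD mh h0 hle.
have mh' n : measurable_fun D (fun w => (h_ n w)%:E) by exact/measurable_EFinP.
have h0' n w : D w -> (0 <= (h_ n w)%:E)%E by rewrite lee_fin.
have sum_fin : (\int[mu]_(w in D) (\sum_(n <oo) (h_ n w)%:E) < +oo)%E.
  rewrite integral_nneseries//.
  apply: (@le_lt_trans _ _ (\sum_(n <oo) (1 / (2 ^ n.+1)%:R)%:E)%E).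
    apply: lee_nneseries => [n _ _|n _]; last exact: hle.
    by apply: integral_ge0 => w Dw; exact: h0'.
  by apply: le_lt_trans (epsilon_trick0 xpredT ler01) _; exact: ltry.
have : mu.-integrable D (fun w => \sum_(n <oo) (h_ n w)%:E)%E.
  apply/integrableP; split; first by apply: ge0_emeasurable_sum => // n w Dw _; exact: h0'.
  rewrite (eq_integral (fun w => \sum_(n <oo) (h_ n w)%:E)%E)// => w wD.
  by rewrite gee0_abs//; apply: nneseries_ge0 => *; rewrite lee_fin.
move=> /integrable_ae-/(_ mD); apply: filterS => w /[apply] fw.
apply: cvg_series_cvg_0; apply: nnseries_is_cvg => //.
by rewrite -ge0_fin_numE//; apply: nneseries_ge0 => *; rewrite lee_fin.
Qed.

(** * Measurability, integrability and limits *)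

(** Monotonicity turns the superlevel sets of [f] on the positive half-line into intervals. *)
Lemma antitone_comp_measurable d (T : measurableType d) (R : realType)
    (f : R -> R) (g : T -> R) :
  (forall q r, 0 < q -> q <= r -> f r <= f q) -> measurable_fun setT g ->
  (forall w, 0 < g w) -> measurable_fun setT (f \o g).
Proof.
move=> f_ni mg g0.
apply: (measurability (@RGenCInfty.G R)) => [|/= _ [_] [r] -> <-].
  exact: RGenCInfty.measurableE.
have mI : measurable [set q | 0 < q /\ r <= f q].
  apply: is_interval_measurable => s t/= [s0 fs] [t0 ft] u /andP[su ut].
  have u0 := lt_le_trans s0 su; split => //.
  by apply: (le_trans ft); exact: f_ni.
rewrite setTI; have := mg measurableT _ mI; rewrite setTI; congr (measurable _).
by apply/seteqP; split => w /=; rewrite in_itv/= andbT; [case|split].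
Qed.

Lemma integrable_sandwich d (T : measurableType d) (R : realType)
    (mu : {measure set T -> \bar R}) (f a b : T -> \bar R) :
  measurable_fun setT f -> mu.-integrable setT a -> mu.-integrable setT b ->
  (forall w, a w <= f w)%E -> (forall w, f w <= b w)%E -> mu.-integrable setT f.
Proof.
move=> mf ia ib af fb.
have iab : mu.-integrable setT ((abse \o a) \+ (abse \o b))%E.
  by apply: integrableD => //; exact: integrable_abse.
apply: (le_integrable _ _ _ iab) => // w _ /=.
rewrite [leRHS]gee0_abs ?adde_ge0//.
have [f0|f0] := leP 0%E (f w).
  rewrite gee0_abs//; apply: (le_trans (fb w)); apply: (le_trans (lee_abs _)).
  by rewrite leeDr.
rewrite lee0_abs; last exact: ltW.
apply: (@le_trans _ _ (- a w)%E); first by rewrite leeN2.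
by apply: (le_trans (lee_abs _)); rewrite abseN leeDl.
Qed.

(** Real test levels below [h] cover the case of an infinite [h] as well. *)
Lemma le_limn_einf (R : realType) (u : (\bar R)^nat) (h : \bar R) :
  (forall r : R, (r%:E < h)%E -> exists N, forall n, (N <= n)%N -> (r%:E <= u n)%E) ->
  (h <= limn_einf u)%E.
Proof.
move=> hu; rewrite leNgt; apply/negP => sh.
have [r /andP[sr /hu[N hN]]] : exists r : R, (limn_einf u < r%:E < h)%E.
  move: sh; move: (limn_einf u) h {hu} => [s| |] [h| |]//; rewrite ?lte_fin => sh.
  - by exists ((s + h) / 2); rewrite !lte_fin; apply/andP; split; lra.
  - by exists (s + 1); rewrite lte_fin ltry andbT; lra.
  - by exists (h - 1); rewrite lte_fin ltNyr/=; lra.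
  - by exists 0; rewrite ltNyr ltry.
move: sr; apply/negP; rewrite -leNgt limn_einf_lim.
apply: lime_ge; first exact: is_cvg_einfs.
exists N => // n /= Nn; apply: le_ereal_inf_tmp => _ /= [m nm <-].
by apply: hN; exact: leq_trans Nn nm.
Qed.

Lemma limn_einf_le (R : realType) (u : (\bar R)^nat) (l : \bar R) :
  (forall n, (u n <= l)%E) -> (limn_einf u <= l)%E.
Proof.
move=> ul; rewrite limn_einf_lim; apply: lime_le; first exact: is_cvg_einfs.
apply: nearW => n; apply: le_trans (ul n).
by apply: ereal_inf_lbound; exists n => /=.
Qed.

Lemma limn_einf_ge0 (R : realType) (u : (\bar R)^nat) :
  (forall n, (0 <= u n)%E) -> (0 <= limn_einf u)%E.
Proof.
move=> u0; apply: le_limn_einf => r r0; exists 0%N => n _.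
by apply: le_trans (u0 n); exact: ltW.
Qed.

Lemma measurable_fun_limn_einf d (T : measurableType d) (R : realType)
    (D : set T) (f : (T -> \bar R)^nat) : (forall n, measurable_fun D (f n)) ->
  measurable_fun D (fun w => limn_einf (f ^~ w)).
Proof.
move=> mf; rewrite (_ : (fun w => _) =
    (fun w => - limn_esup (fun n => - f n w))%E); last first.
  by apply/funext => w; rewrite [X in (- X)%E](limn_esupN (f ^~ w)) oppeK.
apply: measurableT_comp => //; apply: measurable_fun_limn_esup => n.
exact: measurableT_comp.
Qed.

Lemma near_inv_pow2_lt (R : realType) (e : R) : 0 < e ->
  exists N, forall n, (N <= n)%N -> 1 / (2 ^ n.+1)%:R < e.
Proof.
move=> e0; have [N hN] : exists N : nat, e^-1 < N%:R.
  by exists (Num.bound e^-1); apply: archi_boundP; rewrite invr_ge0 ltW.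
exists N => n Nn; rewrite div1r invf_plt ?posrE ?ltr0n ?expn_gt0//.
apply: (lt_le_trans hN); rewrite ler_nat; apply: (leq_trans Nn).
by apply: ltnW; apply: ltnW; exact: ltn_expl.
Qed.

(** Tychonoff's theorem replaces a diagonal argument: a neighbourhood of a cluster point in the
    product of the intervals controls any finite set of coordinates. *)
Lemma product_cluster (R : realType) (p : nat -> nat -> R) (b : nat -> R) :
  (forall n i, 0 <= p n i <= b i) ->
  exists q : nat -> R, (forall i, 0 <= q i <= b i) /\
    forall N (e : R), 0 < e ->
      exists2 n, (N <= n)%N & forall i, (i <= N)%N -> `|p n i - q i| < e.
Proof.
move=> pb; pose K i : set R := `[0, b i]%classic.
have cK := @tychonoff nat (fun=> R) K (fun i => @segment_compact R 0 (b i)).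
have FK : (p @ \oo) [set g : prod_topology (fun _ : nat => R) | forall i, K i (g i)].
  by exists 0%N => // n _ i; rewrite /K /= in_itv/=.
have [q [Kq clq]] := cK (p @ \oo) _ FK.
exists q; split; first by move=> i; have := Kq i; rewrite /K /= in_itv.
move=> N e e0.
pose Q := prod_topology (fun _ : nat => R).
have FQ : Filter (nbhs (q : Q)) by exact: nbhs_filter.
have nq M : nbhs (q : Q) [set g : Q | forall i, (i < M)%N -> `|g i - q i| < e].
  elim: M => [|M IH].
    by rewrite (_ : [set g | _] = setT); [exact: (@filterT _ _ FQ)|apply/seteqP].
  have nM : nbhs (q : Q) [set g : Q | `|g M - q M| < e].
    have := @proj_continuous nat (fun=> R) M q _ (nbhsx_ballx (q M) e e0).
    by apply: (@filterS _ _ FQ) => g; rewrite /ball/= distrC.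
  have := @filterI _ _ FQ _ _ IH nM.
  apply: (@filterS _ _ FQ) => g [IHg gM] i; rewrite ltnS leq_eqVlt.
  by move=> /predU1P[->//|]; exact: IHg.
have pN : (p @ \oo) (p @` [set n | (N <= n)%N]).
  by exists N => // n /= Nn; exists n.
have [g [/= [n Nn <-] gq]] := clq _ _ pN (nq N.+1).
by exists n => // i iN; exact: gq.
Qed.

(** * Existence of an optimal payoff *)

Section OptimalPayoff.
Context {R : realType} {d : measure_display} {T : measurableType d}.
Context (P : probability T R) (U : R -> R) (rho : T -> R).
Hypotheses (HU : utility U) (rho_gt0 : forall w, 0 < rho w)
  (mrho : measurable_fun setT rho)
  (irho : P.-integrable setT (fun w => (rho w)%:E))
  (Vfin : forall y, 0 < y -> (\int[P]_w conjugate U (y * rho w) < +oo)%E).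

Let V y w := fine (conjugate U (y * rho w)).

(** The test point 1 in the conjugate gives the integrable lower bound [U 1 - y * rho w], which
    controls the negative part; [Vfin] then makes the positive part integrable. *)
Lemma integrable_conjugate y : 0 < y -> P.-integrable setT (fun w => (V y w)%:E).
Proof.
move=> y0; have yr w : 0 < y * rho w by exact: mulr_gt0.
have VE w : (V y w)%:E = conjugate U (y * rho w) by rewrite fineK// conjugate_fin_num.
have mV : measurable_fun setT (fun w => (V y w)%:E).
  apply/measurable_EFinP.
  apply: (@antitone_comp_measurable _ _ _ (fun q => fine (conjugate U q)) (fun w => y * rho w)) => //.
    move=> q r q0 qr; rewrite fine_le ?conjugate_fin_num ?(lt_le_trans q0)//.
    exact: conjugate_nonincr.
  exact: measurable_funM.
have ia : P.-integrable setT (fun w => (U 1 - y * rho w)%:E).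
  under eq_fun do rewrite EFinB EFinM.
  apply: integrableB => //; first exact: finite_measure_integrable_cst.
  exact: integrableZl.
have aV w : ((U 1 - y * rho w)%:E <= (V y w)%:E)%E.
  by rewrite VE -[X in (_ - X)%R]mul1r; apply: conjugate_ge.
have ineg : P.-integrable setT (fun w => (V y w)%:E)^\-%E.
  apply: le_integrable (integrable_funeneg measurableT ia) => //.
    exact: measurable_funeneg.
  move=> w _; rewrite !gee0_abs// !unlock ge_max !le_max leeN2 aV/=.
  by rewrite lexx orbT.
have ipos : P.-integrable setT (fun w => (V y w)%:E)^\+%E.
  apply/integrableP; split; first exact: measurable_funepos.
  rewrite (eq_integral (fun w => (V y w)%:E)^\+%E); last by move=> w _; rewrite gee0_abs.
  have Vf : (\int[P]_w (V y w)%:E < +oo)%E.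
    by rewrite (eq_integral (fun w => conjugate U (y * rho w))) ?Vfin// => w _; rewrite VE.
  rewrite integralE in Vf; move: (integrable_fin_num measurableT ineg) Vf.
  case: (\int[P]_w _^\- w)%E => // r _.
  by case: (\int[P]_w _^\+ w)%E => //= s _; exact: ltry.
rewrite (_ : (fun w => _) = (fun w => (V y w)%:E)^\+ \- (fun w => (V y w)%:E)^\-)%E.
  exact: integrableB.
exact: funeposneg.
Qed.

Lemma integrable_deflated (f : T -> R) (K : R) : measurable_fun setT f ->
  (forall w, 0 <= f w) -> (\int[P]_w (rho w * f w)%:E <= K%:E)%E ->
  P.-integrable setT (fun w => (rho w * f w)%:E).
Proof.
move=> mf f0 fK; apply/integrableP; split.
  by apply/measurable_EFinP; exact: measurable_funM.
rewrite (eq_integral (fun w => (rho w * f w)%:E)).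
  by apply: (le_lt_trans fK); exact: ltry.
by move=> w _; rewrite gee0_abs// lee_fin mulr_ge0// ltW.
Qed.

Lemma integrable_conjugateD y (f : T -> R) (K : R) : 0 < y ->
  measurable_fun setT f -> (forall w, 0 <= f w) ->
  (\int[P]_w (rho w * f w)%:E <= K%:E)%E ->
  P.-integrable setT (fun w => (V y w + y * rho w * f w)%:E) /\
  (\int[P]_w (V y w + y * rho w * f w)%:E =
    \int[P]_w (V y w)%:E + y%:E * \int[P]_w (rho w * f w)%:E)%E.
Proof.
move=> y0 mf f0 fK; have irf := integrable_deflated mf f0 fK.
have iV := integrable_conjugate y0.
have iyrf : P.-integrable setT (fun w => y%:E * (rho w * f w)%:E)%E by exact: integrableZl.
under eq_fun do rewrite EFinD -mulrA EFinM.
split; first exact: integrableD.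
by rewrite integralD// integralZl.
Qed.

Lemma Ubar_le_conjugateD y (f : T -> R) w : 0 < y -> 0 <= f w ->
  (Ubar U (f w) <= (V y w + y * rho w * f w)%:E)%E.
Proof. by move=> y0 f0; apply: Ubar_le_conjugate => //; exact: mulr_gt0. Qed.

Lemma measurable_Ubar_comp (f : T -> R) : measurable_fun setT f ->
  measurable_fun setT (fun w => Ubar U (f w)).
Proof. by move=> mf; apply: (measurableT_comp (measurable_Ubar HU)). Qed.

(** The value [-oo] also encodes a negative part of infinite integral, so excluding it controls the
    utility from below; from above it is bounded by [V 1 w + 1 * rho w * f w]. *)
Lemma expected_utility_integrable (f : T -> R) (K : R) : measurable_fun setT f ->
  (forall w, 0 <= f w) -> (\int[P]_w (rho w * f w)%:E <= K%:E)%E ->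
  (-oo < expected_utility P U f)%E ->
  P.-integrable setT (fun w => Ubar U (f w)).
Proof.
move=> mf f0 fK; rewrite /expected_utility; case: ifP => // ineg _.
have [iVf _] := integrable_conjugateD ltr01 mf f0 fK.
have mU := measurable_Ubar_comp mf.
apply: (@integrable_sandwich _ _ _ _ _ (\- (fun w => Ubar U (f w))^\-)%E _ mU _ iVf).
- apply: integrableN; apply/integrableP; split; first exact: measurable_funeneg.
  by rewrite (eq_integral (fun w => Ubar U (f w))^\-%E)// => w _; rewrite gee0_abs.
- by move=> w; rewrite !unlock/= leeNl le_max lexx.
- by move=> w; exact: Ubar_le_conjugateD.
Qed.

Lemma integrable_expected_utility (f : T -> R) :
  P.-integrable setT (fun w => Ubar U (f w)) ->
  expected_utility P U f = (\int[P]_w Ubar U (f w))%E.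
Proof.
by move=> i; rewrite /expected_utility integral_funeneg_lt_pinfty.
Qed.

(** The gap in the Fenchel inequality is lower semicontinuous in the payoff because [Ubar U] is
    upper semicontinuous. A real bound [b] of [Ubar U] near [g w] covers the case where the utility
    is [-oo]. *)
Lemma le_limn_einf_gap (g_ : nat -> T -> R) (g : T -> R) y w : 0 < y ->
  g_ ^~ w @ \oo --> g w ->
  ((V y w + y * rho w * g w)%:E - Ubar U (g w) <=
    limn_einf (fun n => (V y w + y * rho w * g_ n w)%:E - Ubar U (g_ n w)))%E.
Proof.
move=> y0 gc; apply: le_limn_einf => r.
set a := V y w + y * rho w * g w => ra.
have /(Ubar_usc HU)[e e0 ge] : (Ubar U (g w) < (a - r)%:E)%E.
  move: ra; have := Ubar_lty U (g w).
  by case: (Ubar U (g w)) => [u| |]//; rewrite ?ltNyr// -EFinB !lte_fin; lra.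
have [b gb ba] : exists2 b : R, (Ubar U (g w + e) <= b%:E)%E & b < a - r.
  move: ge; have := Ubar_lty U (g w + e).
  case: (Ubar U (g w + e)) => [u| |]// _; first by rewrite lte_fin; exists u.
  by exists (a - r - 1); rewrite ?leNye//; lra.
have ac : (fun n => V y w + y * rho w * g_ n w) @ \oo --> a.
  by apply: cvgD; [exact: cvg_cst|apply: cvgM => //; exact: cvg_cst].
have ab : 0 < a - r - b by lra.
have /cvgrPdist_lt/(_ _ ab)[N1 _ hN1] := ac.
have /cvgrPdist_lt/(_ _ e0)[N2 _ hN2] := gc.
exists (maxn N1 N2) => n; rewrite geq_max => /andP[/hN1/= n1 /hN2/= n2].
have : (Ubar U (g_ n w) <= b%:E)%E.
  by apply: le_trans gb; apply: le_Ubar => //; move: n2; rewrite ltr_distlC; lra.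
move: n1; rewrite ltr_distlC => /andP[n1 _].
by case: (Ubar U (g_ n w)) => [u| |]//; rewrite ?leey// -EFinB !lee_fin; lra.
Qed.

Lemma deflated_fatou D (f_ : nat -> T -> R) (f : T -> R) (K : R) : measurable D ->
  (forall n, measurable_fun setT (f_ n)) -> (forall n w, 0 <= f_ n w) ->
  measurable_fun setT f -> (forall w, 0 <= f w) ->
  {ae P, forall w, D w -> f_ ^~ w @ \oo --> f w} ->
  (forall n, \int[P]_(w in D) (rho w * f_ n w)%:E <= K%:E)%E ->
  (\int[P]_(w in D) (rho w * f w)%:E <= K%:E)%E.
Proof.
move=> mD mf_ f_0 mf f0 fc fK.
have mrf g : measurable_fun setT g -> measurable_fun D (fun w => (rho w * g w)%:E).
  move=> mg; apply/measurable_EFinP; apply: measurable_funTS.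
  exact: measurable_funM.
have rf0 g : (forall w, 0 <= g w) -> forall w, D w -> (0 <= (rho w * g w)%:E)%E.
  by move=> g0 w _; rewrite lee_fin mulr_ge0// ltW.
apply: (@le_trans _ _ (\int[P]_(w in D) limn_einf (fun n => (rho w * f_ n w)%:E))%E).
  apply: ae_ge0_le_integral => //; [exact: rf0|exact: mrf|..].
  - by move=> w Dw; apply: limn_einf_ge0 => n; exact: (rf0 (f_ n)).
  - by apply: measurable_fun_limn_einf => n; exact: mrf.
  - move: fc; apply: filterS => w /[apply] fw.
    have : (fun n => (rho w * f_ n w)%:E) @ \oo --> (rho w * f w)%:E.
      apply/fine_cvgP; split; first exact: nearW.
      by apply: cvgM => //; exact: cvg_cst.
    by move=> /cvg_limn_einf_sup[->].
apply: le_trans (fatou _ _ _ _) _ => //.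
- by move=> n; exact: mrf.
- by move=> n; exact: (rf0 (f_ n)).
- exact: limn_einf_le.
Qed.

(** Utilities have no sign, but the Fenchel gap [H] is nonnegative, so Fatou's lemma applies to it.
    The integral of the conjugate cancels and the loss is at most [y * K], which vanishes as [y]
    tends to 0. *)
Lemma expected_utility_fatou (g_ : nat -> T -> R) (g : T -> R) (K l : R) :
  (forall n, measurable_fun setT (g_ n)) -> (forall n w, 0 <= g_ n w) ->
  measurable_fun setT g -> (forall w, 0 <= g w) ->
  {ae P, forall w, g_ ^~ w @ \oo --> g w} ->
  (forall n, \int[P]_w (rho w * g_ n w)%:E <= K%:E)%E ->
  (forall n, P.-integrable setT (fun w => Ubar U (g_ n w))) ->
  (forall n, l%:E <= \int[P]_w Ubar U (g_ n w))%E ->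
  (\int[P]_w (rho w * g w)%:E <= K%:E)%E /\
  (l%:E <= expected_utility P U g)%E.
Proof.
move=> mg_ g_0 mg g0 gc gK iU lU.
have gK' : (\int[P]_w (rho w * g w)%:E <= K%:E)%E.
  apply: (deflated_fatou (f_ := g_)) => //; move: gc; exact: filterS.
have K0 : 0 <= K.
  rewrite -lee_fin; apply: le_trans gK'.
  by apply: integral_ge0 => w _; rewrite lee_fin mulr_ge0// ltW.
have key y : 0 < y -> P.-integrable setT (fun w => Ubar U (g w)) /\
    (l%:E - (y * K)%:E <= \int[P]_w Ubar U (g w))%E.
  move=> y0; have [iW WE] := integrable_conjugateD y0 mg g0 gK'.
  pose W (f : T -> R) w := (V y w + y * rho w * f w)%:E.
  pose H (f : T -> R) w := (W f w - Ubar U (f w))%E.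
  have mH f : measurable_fun setT f -> measurable_fun setT (H f).
    move=> mf; apply: emeasurable_funB; last exact: measurable_Ubar_comp.
    apply/measurable_EFinP; apply: measurable_funD.
      by have /measurable_int/measurable_EFinP := integrable_conjugate y0.
    by apply: measurable_funM => //; exact: measurable_funM.
  have H0 f : (forall w, 0 <= f w) -> forall w, (0 <= H f w)%E.
    move=> f0 w; have := Ubar_le_conjugateD (w := w) y0 (f0 w); rewrite /H /W.
    by case: (Ubar U (f w)) => [u|//|_]; [rewrite -EFinB !lee_fin; lra|rewrite leey].
  have [v VE] : exists v, (\int[P]_w (V y w)%:E)%E = v%:E.
    have := integrable_fin_num measurableT (integrable_conjugate y0).
    by case: (integral _ _ _) => // v _; exists v.
  have HK n : (\int[P]_w H (g_ n) w <= (v + y * K - l)%:E)%E.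
    have [iWn WnE] := integrable_conjugateD y0 (mg_ n) (g_0 n) (gK n).
    rewrite /H /W integralB// WnE VE !EFinD EFinN; apply: leeB => //.
    by rewrite leeD2l// EFinM lee_wpmul2l// lee_fin ltW.
  have HgK : (\int[P]_w H g w <= (v + y * K - l)%:E)%E.
    apply: (@le_trans _ _ (\int[P]_w limn_einf (fun n => H (g_ n) w))%E).
      apply: ae_ge0_le_integral => //; [by move=> w _; exact: H0|exact: mH|..].
      - by move=> w _; apply: limn_einf_ge0 => n; exact: H0.
      - by apply: measurable_fun_limn_einf => n; exact: mH.
      - by move: gc; apply: filterS => w gw _; exact: le_limn_einf_gap.
    apply: le_trans (fatou _ _ _ _) _ => //.
    - by move=> n; exact: mH.
    - by move=> n w _; exact: H0.
    - exact: limn_einf_le.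
  have iH : P.-integrable setT (H g).
    apply/integrableP; split; first exact: mH.
    rewrite (eq_integral (H g)); first by apply: (le_lt_trans HgK); exact: ltry.
    by move=> w _; rewrite gee0_abs// H0.
  (* The identity persists where the utility is [-oo], since [H g] is [+oo] there. *)
  have UE : (fun w => Ubar U (g w)) = (W g \- H g)%E.
    apply/funext => w; rewrite /H /W /=; have := Ubar_lty U (g w).
    by case: (Ubar U (g w)) => [u|//|] _ //; rewrite -!EFinB; congr _%:E; lra.
  rewrite UE; split; first exact: integrableB.
  rewrite integralB// WE VE.
  apply: (@le_trans _ _ (v%:E - (v + y * K - l)%:E)%E).
    by rewrite -!EFinB lee_fin; lra.
  apply: leeB => //; rewrite leeDl//; apply: mule_ge0; first by rewrite lee_fin ltW.
  by apply: integral_ge0 => w _; rewrite lee_fin mulr_ge0// ltW.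
split => //; have [iU' _] := key 1 ltr01; rewrite integrable_expected_utility//.
apply/lee_addgt0Pr => e e0.
have K1 : 0 < K + 1 by lra.
(* Dividing by [K + 1] keeps the loss [y * K] below [e] even when [K] is 0. *)
have [_] := key (e / (K + 1)) (divr_gt0 e0 K1).
rewrite leeBlDr// => /le_trans; apply; rewrite leeD2l// lee_fin mulrAC ler_pdivrMr//.
by rewrite ler_pM2l//; lra.
Qed.

(** * Lagrangian maximizers and the multiplier on an atomless set *)

(** Optimality of [x] is tested at the constant [e], and [Ubar U x] is bounded by the conjugate at
    another multiplier [z]. For [z < y] this dominates the cost [rho w * x] by an integrable
    function. *)
Lemma maximizer_bound y z e x w : 0 < z -> 0 < e ->
  maximizer U (y * rho w) x ->
  (y - z) * (rho w * x) <= V z w - U e + y * e * rho w.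
Proof.
move=> z0 e0 mx; have [x0 /(_ e (ltW e0))] := mx; rewrite UbarE//.
move=> /le_trans/(_ (Ubar_le_conjugate HU (mulr_gt0 z0 (rho_gt0 w)) x0)).
by rewrite -EFinD lee_fin -/(V z w); lra.
Qed.

Lemma le_deflated_integral D (f g : T -> R) : measurable D ->
  measurable_fun setT f -> measurable_fun setT g -> (forall w, 0 <= f w) ->
  (forall w, f w <= g w) ->
  (\int[P]_(w in D) (rho w * f w)%:E <= \int[P]_(w in D) (rho w * g w)%:E)%E.
Proof.
move=> mD mf mg f0 fg; apply: ge0_le_integral => //.
- by move=> w _; rewrite lee_fin mulr_ge0// ltW.
- by apply/measurable_EFinP; apply: measurable_funTS; exact: measurable_funM.
- by apply/measurable_EFinP; apply: measurable_funTS; exact: measurable_funM.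
- by move=> w _; rewrite lee_fin ler_pM2l.
Qed.

(** The maximizer is selected as a function [xi] of the real number [y * rho w]. As [xi] is antitone
    on positive slopes, measurability in [w] and monotonicity in [y] come without a measurable
    selection theorem. *)
Lemma exists_integrable_maximizer : exists X : R -> T -> R,
  [/\ forall y w, 0 < y -> maximizer U (y * rho w) (X y w),
      forall y w, 0 <= X y w,
      forall y z w, 0 < y -> y <= z -> X z w <= X y w,
      forall y, measurable_fun setT (X y) &
      forall y, 0 < y -> P.-integrable setT (fun w => (rho w * X y w)%:E)].
Proof.
(* The default value 0 at nonpositive slopes keeps [X y] nonnegative and measurable for every real
   [y]. *)
have xiE q : exists x, (0 < q -> maximizer U q x) /\ (q <= 0 -> x = 0).
  have [q0|q0] := ltP 0 q; first by have [x mx] := maximizer_exists HU q0; exists x; split=> //; lra.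
  by exists 0; split=> // q1; move: q0; rewrite leNgt q1.
have [xi xiP] := choice xiE.
have xi_ni q r : 0 < q -> q <= r -> xi r <= xi q.
  move=> q0; rewrite le_eqVlt => /predU1P[->//|qr].
  by apply: (maximizer_antimono qr); apply: (xiP _).1 => //; exact: lt_trans qr.
pose X y w := xi (y * rho w).
have yr y w : 0 < y -> 0 < y * rho w by move=> y0; exact: mulr_gt0.
have XP y w : 0 < y -> maximizer U (y * rho w) (X y w) by move=> /yr /(xiP _).1.
have X0 y w : 0 <= X y w.
  have [y0|y0] := ltP 0 y; first by have [] := XP y w y0.
  rewrite /X (xiP _).2//.
  by rewrite mulr_le0_ge0// ltW.
have mX y : measurable_fun setT (X y).
  have [y0|y0] := ltP 0 y.
    apply: (@antitone_comp_measurable _ _ _ xi (fun w => y * rho w)) => //.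
    - exact: measurable_funM.
    - by move=> w; exact: yr.
  rewrite (_ : X y = cst 0); first exact: measurable_cst.
  by apply/funext => w; rewrite /X (xiP _).2// mulr_le0_ge0// ltW.
exists X; split => //.
  by move=> y z w y0 yz; apply: xi_ni; [exact: yr|rewrite ler_pM2r].
(* The dominating function is [maximizer_bound] with [z = y / 2] and [e = 1], divided by [y / 2]. *)
move=> y y0; have y20 : 0 < y / 2 by lra.
have mrX : measurable_fun setT (fun w => (rho w * X y w)%:E).
  by apply/measurable_EFinP; exact: measurable_funM.
have ib : P.-integrable setT
    (fun w => (2 / y)%:E * ((V (y / 2) w)%:E - (U 1)%:E + y%:E * (rho w)%:E))%E.
  apply: integrableZl => //; apply: integrableD => //; last exact: integrableZl.
  apply: integrableB => //; last exact: finite_measure_integrable_cst.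
  exact: integrable_conjugate.
have i0 : P.-integrable setT (cst 0%E : T -> \bar R) by exact: integrable0.
apply: (integrable_sandwich mrX i0 ib) => //.
  by move=> w; rewrite lee_fin mulr_ge0// ltW.
move=> w; rewrite [leRHS](_ : _ = (2 / y * (V (y / 2) w - U 1 + y * rho w))%:E)// lee_fin.
have := maximizer_bound y20 ltr01 (XP y w y0).
move=> b; rewrite [leRHS]mulrAC ler_pdivlMr//; move: b.
by move: (rho w * X y w) => p; lra.
Qed.

(** By Fatou's lemma the limit of the deflated payoffs is integrable, hence a.e. finite; for a
    monotone sequence this is convergence, and dividing by [rho w > 0] returns to [f_]. *)
Lemma ae_bounded_of_deflated D (f_ : nat -> T -> R) c : measurable D ->
  (forall n, measurable_fun setT (f_ n)) -> (forall n w, 0 <= f_ n w) ->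
  (forall m n w, (m <= n)%N -> f_ m w <= f_ n w) ->
  (forall n, \int[P]_(w in D) (rho w * f_ n w)%:E <= c%:E)%E ->
  {ae P, forall w, D w -> cvgn (f_ ^~ w)}.
Proof.
move=> mD mf f0 nd fc.
have mL : measurable_fun D (fun w => limn_einf (fun n => (rho w * f_ n w)%:E)).
  apply: measurable_fun_limn_einf => n; apply/measurable_EFinP.
  by apply: measurable_funTS; exact: measurable_funM.
have L0 w : (0 <= limn_einf (fun n => (rho w * f_ n w)%:E))%E.
  by apply: limn_einf_ge0 => n; rewrite lee_fin mulr_ge0// ltW.
have : P.-integrable D (fun w => limn_einf (fun n => (rho w * f_ n w)%:E)).
  apply/integrableP; split => //; apply: (@le_lt_trans _ _ c%:E); last exact: ltry.
  rewrite (eq_integral (fun w => limn_einf (fun n => (rho w * f_ n w)%:E))).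
    apply: le_trans (fatou _ _ _ _) _ => //.
    - move=> n; apply/measurable_EFinP.
      by apply: measurable_funTS; exact: measurable_funM.
    - by move=> n w _; rewrite lee_fin mulr_ge0// ltW.
    - exact: limn_einf_le.
  by move=> w _; rewrite gee0_abs.
move=> /integrable_ae-/(_ mD); apply: filterS => w /[apply].
have ndu : {homo (fun n => (rho w * f_ n w)%:E) : n m / (n <= m)%N >-> (n <= m)%E}.
  by move=> m n mn; rewrite lee_fin ler_pM2l// nd.
have uc := ereal_nondecreasing_cvgn ndu.
rewrite (cvg_limn_einf_sup uc).1 => ufin; move: uc; rewrite -(fineK ufin).
set l := fine _ => /fine_cvgP[_ lc]; apply/cvg_ex; exists ((rho w)^-1 * l).
have -> : f_ ^~ w = (fun n => (rho w)^-1 * (rho w * f_ n w)).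
  by apply/funext => n; rewrite mulKf// gt_eqF.
by apply: cvgM => //; exact: cvg_cst.
Qed.

(** The conclusion lists the Kuhn-Tucker conditions: pointwise optimality, feasibility, and
    complementary slackness, where part of the budget may stay unspent when [y = 0]. *)
Lemma nonatomic_lagrangian D (c : R) : measurable D -> nonatomic P D -> 0 < c ->
  exists (y : R) (f : T -> R), [/\ 0 <= y, measurable_fun setT f, forall w, 0 <= f w,
    {ae P, forall w, D w -> maximizer U (y * rho w) (f w)} &
    (\int[P]_(w in D) (rho w * f w)%:E <= c%:E)%E /\
    (y%:E * \int[P]_(w in D) (rho w * f w)%:E = (y * c)%:E)%E].
Proof.
move=> mD naD c0.
have [X [XP X0 Xni mX iX]] := exists_integrable_maximizer.
have iD (f : T -> \bar R) : P.-integrable setT f -> P.-integrable D f.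
  exact: integrableS.
have intE (f : T -> \bar R) : P.-integrable D f ->
    exists r, (\int[P]_(w in D) f w)%E = r%:E.
  move=> /(integrable_fin_num mD); case: (integral _ _ _) => // r _.
  by exists r.
pose h y := (\int[P]_(w in D) (rho w * X y w)%:E)%E.
have h_ni y z : 0 < y -> y <= z -> (h z <= h y)%E.
  by move=> y0 yz; apply: le_deflated_integral => // w; exact: Xni.
(* A large multiplier is affordable. With [z = 1], [maximizer_bound] integrates to
   [(y - 1) * H <= J + y * e * I]; [e] ensures [e * I <= c / 4], and [y * c = 2 * c + 4 * |J|] makes
   the right side at most [(y - 1) * c]. *)
have [y1 y10 hy1] : exists2 y, 0 < y & (h y <= c%:E)%E.
  have [I IE] := intE _ (iD _ irho).
  have I0 : 0 <= I.
    by rewrite -lee_fin -IE integral_ge0// => w _; rewrite lee_fin ltW.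
  pose e := c / (4 * (I + 1)).
  have I1 : 0 < 4 * (I + 1) by lra.
  have e0 : 0 < e by exact: divr_gt0.
  have eI : e * I <= c / 4.
    have : e * (4 * (I + 1)) = c by rewrite /e divfK// gt_eqF.
    by lra.
  have iG : P.-integrable D (fun w => (V 1 w)%:E - (U e)%:E)%E.
    apply: integrableB => //; last exact: finite_measure_integrable_cst.
    by apply: iD; exact: integrable_conjugate.
  have [J JE] := intE _ iG.
  pose y := 2 + 4 * `|J| / c.
  have cy : y * c = 2 * c + 4 * `|J| by rewrite /y mulrDl divfK// gt_eqF.
  have y2 : 2 <= y by rewrite lerDl divr_ge0// ?ltW// mulr_ge0.
  have y0 : 0 < y by lra.
  exists y => //; have [H HE] := intE _ (iD _ (iX y y0)).
  rewrite /h HE lee_fin.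
  have : (((y - 1) * H)%:E <= (J + y * e * I)%:E)%E.
    rewrite EFinM -HE -integralZl//; last by apply: iD; exact: iX.
    rewrite [leRHS](_ : _ = J%:E + (y * e)%:E * I%:E)%E// -JE -IE -integralZl//; last exact: iD.
    rewrite -integralD//; last by apply: integrableZl => //; exact: iD.
    apply: le_integral => //.
    - by apply: integrableZl => //; apply: iD; exact: iX.
    - by apply: integrableD => //; apply: integrableZl => //; exact: iD.
    - move=> w _; rewrite [leRHS](_ : _ = (V 1 w - U e + y * e * rho w)%:E)// -EFinM lee_fin.
      by apply: maximizer_bound => //; exact: XP.
  rewrite lee_fin => yH.
  have y1 : 0 < y - 1 by lra.
  rewrite -(ler_pM2l y1); apply: (le_trans yH).
  have yeI : y * e * I <= y * c / 4 by rewrite -!mulrA ler_pM2l// mulrA.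
  rewrite mulrBl mul1r; have := ler_norm J; have := normr_ge0 J; move: yeI cy.
  by move: (y * e * I) (y * c) `|J| => p q r; lra.
pose Y := [set y | 0 < y /\ (h y <= c%:E)%E].
have lbY : lbound Y 0 by move=> y [/ltW].
have infY : has_inf Y by split; [exists y1|exists 0].
pose ys := inf Y.
have ys0 : 0 <= ys by apply: lb_le_inf => //; exists y1.
have above z : ys < z -> (h z <= c%:E)%E.
  move=> yz; have zy0 : 0 < z - ys by lra.
  have [y [y0 hy] yz'] := inf_adherent zy0 infY.
  by apply: le_trans hy; apply: h_ni => //; move: yz'; rewrite -/ys; lra.
have below z : 0 < z -> z < ys -> (c%:E < h z)%E.
  move=> z0 zy; rewrite ltNge; apply/negP => hz.
  have : ys <= z by apply: ge_inf; [exists 0|].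
  lra.
have [k [k01 kni kc _]] := exists_vanishing_seq R.
have kpos n : 0 < ys + k n by have := k01 n; lra.
have ndm m n w : (m <= n)%N -> X (ys + k m) w <= X (ys + k n) w.
  by move=> mn; apply: Xni => //; rewrite lerD2l kni.
have hm n : (\int[P]_(w in D) (rho w * X (ys + k n) w)%:E <= c%:E)%E.
  by apply: above; have := k01 n; lra.
(* Along multipliers decreasing to [ys] the maximizers increase at cost at most [c], so they
   converge a.e. on [D], and the limit [fm] is feasible and optimal for [ys]. *)
have cm := ae_bounded_of_deflated mD (fun n => mX _) (fun n => X0 _) ndm hm.
have [fm [mfm fm0 fmP]] := measurable_pointwise_limit (fun n => mX (ys + k n)) (fun n => X0 _).
have cfm : {ae P, forall w, D w -> (fun n => X (ys + k n) w) @ \oo --> fm w}.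
  move: cm; apply: filterS => w /[apply] cw.
  by rewrite (fmP _ _ cw); exact: cw.
have maxm : {ae P, forall w, D w -> maximizer U (ys * rho w) (fm w)}.
  move: cfm; apply: filterS => w /[apply] cw.
  apply: (maximizer_cvg HU (fun n => XP _ w (kpos n)) _ cw).
  apply: cvgM; last exact: cvg_cst.
  by rewrite -[X in _ --> X]addr0; apply: cvgD => //; exact: cvg_cst.
have fmc := deflated_fatou mD (fun n => mX _) (fun n => X0 _) mfm fm0 cfm hm.
(* For multiplier 0 the slackness identity reads [0 = 0], so [fm] already serves. *)
have [ys_gt0|ys_le0] := ltP 0 ys; last first.
  have ysE : ys = 0 by apply/eqP; rewrite eq_le ys0 ys_le0.
  by exists ys, fm; split => //; split => //; rewrite ysE mul0e mul0r.
(* As [k n <= 1], halving it keeps these multipliers positive while they increase to [ys] from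
   below. *)
pose z n := ys * (1 - k n / 2).
have z0 n : 0 < z n by apply: mulr_gt0 => //; have := k01 n; lra.
have zlt n : z n < ys.
  by rewrite -[ltRHS]mulr1 ltr_pM2l//; have := k01 n; lra.
have znd m n : (m <= n)%N -> z m <= z n.
  by move=> mn; rewrite ler_pM2l//; have := kni m n mn; lra.
have [fp [mfp fp0 fpP]] := measurable_pointwise_limit (fun n => mX (z n)) (fun n => X0 _).
have cfp w : (fun n => X (z n) w) @ \oo --> fp w.
  have cw : cvgn (fun n => X (z n) w).
    apply: nonincreasing_is_cvgn; first by move=> m n mn; apply: Xni => //; exact: znd.
    by exists 0 => _ [n _ <-].
  by rewrite (fpP _ _ cw); exact: cw.
have zc : z @ \oo --> ys.
  rewrite -[X in _ --> X]mulr1 -[X in _ * X]subr0 -[X in _ - X](mul0r (2^-1)).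
  apply: cvgM; first exact: cvg_cst.
  apply: cvgB; first exact: cvg_cst.
  by apply: cvgM => //; exact: cvg_cst.
have maxp w : maximizer U (ys * rho w) (fp w).
  apply: (maximizer_cvg HU (fun n => XP _ w (z0 n)) _ (cfp w)).
  by apply: cvgM => //; exact: cvg_cst.
have mrf g : measurable_fun setT g -> measurable_fun D (fun w => (rho w * g w)%:E).
  move=> mg; apply/measurable_EFinP; apply: measurable_funTS.
  exact: measurable_funM.
have ifp : P.-integrable D (fun w => (rho w * fp w)%:E).
  apply: (le_integrable mD (mrf _ mfp) _ (iD _ (iX _ (z0 0%N)))) => w _ /=.
  rewrite lee_fin !ger0_norm ?mulr_ge0// ?(ltW (rho_gt0 w))// ler_pM2l//.
  by apply: (ler_cvg_to (cfp w) (cvg_cst _)); apply: nearW => n; apply: Xni => //; exact: znd.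
(* Each [X (z n)] costs more than [c]; dominated convergence with the largest of them, [X (z 0)],
   carries the bound over to [fp]. *)
have cfpI : (c%:E <= \int[P]_(w in D) (rho w * fp w)%:E)%E.
  have dc : (fun n => \int[P]_(w in D) (rho w * X (z n) w)%:E)%E @ \oo -->
      (\int[P]_(w in D) (rho w * fp w)%:E)%E.
    apply: (@dominated_cvg _ _ _ _ _ mD _ _ (fun w => (rho w * X (z 0%N) w)%:E)).
    - by move=> n; exact: mrf.
    - move=> w _; apply/fine_cvgP; split; first exact: nearW.
      by apply: cvgM => //; exact: cvg_cst.
    - by [].
    - by apply: iD; exact: iX.
    - move=> n w _ /=; rewrite lee_fin ger0_norm ?mulr_ge0// ?(ltW (rho_gt0 w))//.
      by rewrite ler_pM2l//; apply: Xni => //; exact: znd.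
  rewrite -(cvg_lim _ dc)//; apply: lime_ge.
    by apply/cvg_ex; eexists; exact: dc.
  by apply: nearW => n; apply: ltW; exact: below.
(* [fm <= fp] holds only a.e. on [D]; the minimum makes [fp - fn] nonnegative everywhere, as a
   density must be. *)
pose fn w := Num.min (fm w) (fp w).
have mfn : measurable_fun setT fn by exact: measurable_minr.
have fn0 w : 0 <= fn w by rewrite le_min fm0 fp0.
have fnp w : fn w <= fp w by rewrite ge_min lexx orbT.
have fnE : {ae P, forall w, D w -> fn w = fm w}.
  move: cfm; apply: filterS => w /[apply] cw; apply: min_l.
  by apply: (ler_cvg_to cw (cfp w)); apply: nearW => n; apply: Xni => //; have := zlt n; have := k01 n; lra.
have ifn : P.-integrable D (fun w => (rho w * fn w)%:E).
  apply: (le_integrable mD (mrf _ mfn) _ ifp) => w _ /=.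
  by rewrite lee_fin !ger0_norm ?mulr_ge0// ?(ltW (rho_gt0 w))// ler_pM2l.
have [A AE] := intE _ ifp; have [B BE] := intE _ ifn.
have cA : c <= A by rewrite -lee_fin -AE.
have Bc : B <= c.
  rewrite -lee_fin -BE; apply: le_trans fmc.
  by apply: le_deflated_integral => // w; rewrite ge_min lexx.
pose g w := (rho w * (fp w - fn w))%:E.
have mg : measurable_fun setT g.
  apply/measurable_EFinP; apply: measurable_funM => //.
  exact: measurable_funB.
have g0 w : (0 <= g w)%E by rewrite lee_fin mulr_ge0 ?subr_ge0// ltW.
have gI : (\int[P]_(w in D) g w = (A - B)%:E)%E.
  rewrite EFinB -AE -BE -integralB_EFin//; apply: eq_integral => w _.
  by rewrite -EFinB -mulrBr.
(* Switching from [fn], of cost [B], to [fp] on a set [E] whose extra cost is [c - B] spends exactly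
   [c]. *)
have [||E [mE ED EI]] := @integral_intermediate _ _ _ P _ mg g0 D (c - B) mD naD.
- by rewrite gI ltry.
- by rewrite gI !lee_fin; lra.
pose f w := fn w + \1_E w * (fp w - fn w).
have mf : measurable_fun setT f.
  apply: measurable_funD => //; apply: measurable_funM; first exact: measurable_indic.
  exact: measurable_funB.
have f0 w : 0 <= f w by rewrite addr_ge0// mulr_ge0// subr_ge0.
have mgE : measurable_fun D (g \_ E).
  apply: measurable_funTS; apply/(measurable_restrictT _ mE).
  exact: measurable_funTS.
have fI : (\int[P]_(w in D) (rho w * f w)%:E = c%:E)%E.
  rewrite (eq_integral (fun w => (rho w * fn w)%:E + (g \_ E) w)%E); last first.
    move=> w _; rewrite patchE /f indicE; case: (w \in E) => /=.
      by rewrite mul1r mulrDr EFinD.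
    by rewrite mul0r addr0 adde0.
  rewrite ge0_integralD//.
  - by rewrite -integral_mkcondr setIidr// EI BE -EFinD subrKC.
  - by move=> w _; rewrite lee_fin mulr_ge0// ltW.
  - by apply: mrf.
  - by move=> w _; rewrite patchE; case: ifP.
exists ys, f; split => //; last by rewrite fI -EFinM.
apply: filterS2 maxm fnE => w mm fE Dw; rewrite /f indicE.
case: (w \in E) => /=; first by rewrite mul1r addrC subrK; exact: maxp.
by rewrite mul0r addr0 fE//; exact: mm.
Qed.

(** * Modification of the maximizing sequence and passage to the limit *)

(** Integrating the pointwise optimality of [fD] on [D] shows that a change of cost by [S - a]
    changes the utility by at least [y * (S - a)]. The sign of [S - a] is free, so a slight saving
    loses little utility. *)
Lemma lagrangian_improvement D (y S a K : R) (fD f : T -> R) : measurable D ->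
  0 <= y -> measurable_fun setT fD -> (forall w, 0 <= fD w) ->
  (forall w, D w -> maximizer U (y * rho w) (fD w)) ->
  (\int[P]_(w in D) (rho w * fD w)%:E = S%:E)%E ->
  measurable_fun setT f -> (forall w, 0 <= f w) ->
  (\int[P]_w (rho w * f w)%:E <= K%:E)%E ->
  P.-integrable setT (fun w => Ubar U (f w)) ->
  (\int[P]_(w in D) (rho w * f w)%:E = a%:E)%E ->
  let g := fun w => f w + \1_D w * (fD w - f w) in
  [/\ measurable_fun setT g, forall w, 0 <= g w,
      (\int[P]_w (rho w * g w)%:E = \int[P]_w (rho w * f w)%:E + (S - a)%:E)%E,
      P.-integrable setT (fun w => Ubar U (g w)) &
      (\int[P]_w Ubar U (f w) + (y * (S - a))%:E <= \int[P]_w Ubar U (g w))%E].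
Proof.
move=> mD y0 mfD fD0 maxD SE mf f0 fK iUf aE g.
have mg : measurable_fun setT g.
  apply: measurable_funD => //; apply: measurable_funM; first exact: measurable_indic.
  exact: measurable_funB.
have gD w : D w -> g w = fD w by move=> Dw; rewrite /g indicE mem_set// mul1r addrC subrK.
have gnD w : ~ D w -> g w = f w by move=> Dw; rewrite /g indicE memNset// mul0r addr0.
have g0 w : 0 <= g w by have [/gD->|/gnD->] := pselect (D w).
pose del w := \1_D w * (rho w * (fD w - f w)).
have irf : P.-integrable setT (fun w => (rho w * f w)%:E) by exact: integrable_deflated fK.
have irfD : P.-integrable D (fun w => (rho w * fD w)%:E).
  apply/integrableP; split.
    by apply/measurable_EFinP; apply: measurable_funTS; exact: measurable_funM.
  rewrite (eq_integral (fun w => (rho w * fD w)%:E)) ?SE ?ltry// => w _.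
  by rewrite gee0_abs// lee_fin mulr_ge0// ltW.
have irfD' : P.-integrable D (fun w => (rho w * f w)%:E) by exact: integrableS irf.
have iB : P.-integrable D (fun w => (rho w * (fD w - f w))%:E).
  under eq_fun do rewrite mulrBr EFinB.
  exact: integrableB.
have delE : (fun w => (del w)%:E) = (fun w => (rho w * (fD w - f w))%:E) \_ D.
  apply/funext => w; rewrite patchE /del indicE; case: (w \in D) => /=.
    by rewrite mul1r.
  by rewrite mul0r.
have idel : P.-integrable setT (fun w => (del w)%:E).
  by rewrite delE; apply/(integrable_mkcond _ mD).
have Idel : (\int[P]_w (del w)%:E = (S - a)%:E)%E.
  rewrite delE -integral_mkcond; under eq_integral do rewrite mulrBr EFinB.
  by rewrite integralB// SE aE.
have gE w : rho w * g w = rho w * f w + del w by rewrite /g /del mulrDr mulrCA.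
have IgE : (\int[P]_w (rho w * g w)%:E = \int[P]_w (rho w * f w)%:E + (S - a)%:E)%E.
  by under eq_integral do rewrite gE EFinD; rewrite integralD// Idel.
have gK : (\int[P]_w (rho w * g w)%:E <= (K + (S - a))%:E)%E.
  by rewrite IgE [leRHS](_ : _ = K%:E + (S - a)%:E)%E// leeD2r.
have iydel : P.-integrable setT (fun w => y%:E * (del w)%:E)%E by exact: integrableZl.
have iL : P.-integrable setT (fun w => Ubar U (f w) + y%:E * (del w)%:E)%E.
  exact: integrableD.
have Lg w : (Ubar U (f w) + y%:E * (del w)%:E <= Ubar U (g w))%E.
  rewrite -EFinM /del indicE; have [Dw|Dw] := pselect (D w).
    rewrite mem_set// mul1r gD// mulrA; exact: (maxD w Dw).2.
  by rewrite memNset// mul0r mulr0 adde0 gnD.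
have iUg : P.-integrable setT (fun w => Ubar U (g w)).
  have [iW _] := integrable_conjugateD ltr01 mg g0 gK.
  apply: (integrable_sandwich (measurable_Ubar_comp mg) iL iW) => // w.
  exact: Ubar_le_conjugateD.
split => //; rewrite EFinM -Idel -integralZl// -integralD//.
by apply: le_integral => // w _; exact: Lg.
Qed.

(** The values on the atoms and the cost on the complement are the coordinates of a sequence in a
    product of compact intervals. The selection [phi] need not be increasing: [k <= phi k] suffices
    to keep it maximizing. The summable rate serves the case [c = 0]. *)
Lemma atoms_subsequence (A_ : nat -> set T) (f_ : nat -> T -> R) (K : R) :
  (forall i, A_ i = set0 \/ atom P (A_ i)) ->
  (forall n, measurable_fun setT (f_ n)) -> (forall n w, 0 <= f_ n w) ->
  (forall n, \int[P]_w (rho w * f_ n w)%:E <= K%:E)%E ->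
  exists (phi : nat -> nat) (c : R),
  [/\ forall k, (k <= phi k)%N, 0 <= c,
    {ae P, forall w, (\bigcup_i A_ i) w -> cvgn (fun k => f_ (phi k) w)} &
    forall k, `|fine (\int[P]_(w in ~` \bigcup_i A_ i) (rho w * f_ (phi k) w)%:E) - c|
      < 1 / (2 ^ k.+1)%:R].
Proof.
move=> aA mf f0 fK.
set D := ~` _.
have mA i : measurable (A_ i) by have [->|[]] := aA i.
have mD : measurable D by apply: measurableC; exact: bigcup_measurable.
have rf0 n w : (0 <= (rho w * f_ n w)%:E)%E by rewrite lee_fin mulr_ge0// ltW.
have mrf n : measurable_fun setT (fun w => (rho w * f_ n w)%:E).
  by apply/measurable_EFinP; exact: measurable_funM.
have subK n B : measurable B -> (\int[P]_(w in B) (rho w * f_ n w)%:E <= K%:E)%E.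
  move=> mB; apply: le_trans (fK n).
  by apply: ge0_subset_integral.
have K0 : 0 <= K.
  by rewrite -lee_fin; apply: le_trans (subK 0%N _ measurableT); exact: integral_ge0.
have hM i : exists M, forall n, exists v, 0 <= v <= M /\
    {ae P, forall w, A_ i w -> f_ n w = v}.
  have [Ai0|aAi] := aA i.
    exists 0 => n; exists 0; rewrite lexx; split => //.
    by apply: aeW => w; rewrite Ai0.
  have iI : P.-integrable (A_ i) (fun w => (rho w)%:E) by exact: integrableS irho.
  have [I IE] : exists I, (\int[P]_(w in A_ i) (rho w)%:E)%E = I%:E.
    have := integrable_fin_num (mA i) iI.
    by case: (integral _ _ _) => // r _; exists r.
  have I0 : 0 < I.
    have mr : measurable_fun setT (fun w => (rho w)%:E) by exact/measurable_EFinP.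
    have r0 w : (0 <= (rho w)%:E)%E by rewrite lee_fin ltW.
    rewrite -lte_fin -IE; apply: (density_gt0 mr r0) => //.
      by move=> w _; rewrite lte_fin.
    by have [] := aAi.
  (* A payoff equal to [v] on an atom costs [v * I] there, which the budget [K] bounds. *)
  exists (K / I) => n.
  have Pfin : (P setT < +oo)%E by rewrite probability_setT ltry.
  have [v v0 fv] := ae_constant_on_atom Pfin aAi (mf n) (f0 n).
  exists v; rewrite v0/=; split => //; rewrite ler_pdivlMr//.
  rewrite -lee_fin EFinM -IE -integralZl//; apply: le_trans (subK n _ (mA i)).
  apply: ae_ge0_le_integral => //.
  - by move=> w _; rewrite lee_fin mulr_ge0// ltW.
  - by apply: emeasurable_funM => //; exact: measurable_int iI.
  - exact: measurable_funTS.
  - move: fv; apply: filterS => w fv Aw.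
    by rewrite fv// -EFinM mulrC.
have [M hM'] := choice hM.
have hM'' i : exists v : nat -> R, forall n, 0 <= v n <= M i /\
    {ae P, forall w, A_ i w -> f_ n w = v n}.
  by have [v hv] := choice (hM' i); exists v.
have [v hv] := choice hM''.
pose a n := fine (\int[P]_(w in D) (rho w * f_ n w)%:E).
have aK n : 0 <= a n <= K.
  rewrite fine_ge0 ?integral_ge0//= -lee_fin fineK ?subK//.
  by rewrite ge0_fin_numE ?integral_ge0// (le_lt_trans (subK n _ mD)) ?ltry.
(* Coordinate 0 is the cost on [D], and coordinate [j.+1] the value on the atom [A_ j]. *)
pose p n i := if i is j.+1 then v j n else a n.
pose b i := if i is j.+1 then M j else K.
have pb n i : 0 <= p n i <= b i by case: i => [|j] //=; have [] := hv j n.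
have [q [qb clq]] := product_cluster pb.
have phiP k : exists n, (k <= n)%N /\
    forall i, (i <= k)%N -> `|p n i - q i| < 1 / (2 ^ k.+1)%:R.
  have [|n kn h] := clq k (1 / (2 ^ k.+1)%:R).
    by rewrite divr_gt0// ltr0n expn_gt0.
  by exists n.
have [phi hphi] := choice phiP.
exists phi, (q 0%N); split.
- by move=> k; have [] := hphi k.
- by have /andP[] := qb 0%N.
- have ae_v : {ae P, forall w, forall i n, A_ i w -> f_ n w = v i n}.
    apply: ae_foralln => i; apply: ae_foralln => n.
    exact: (hv i n).2.
  move: ae_v; apply: filterS => w fv [i _ Aw].
  apply/cvg_ex; exists (q i.+1).
  apply/cvgrPdist_lt => e e0.
  have [N hN] := near_inv_pow2_lt e0.
  exists (maxn N i.+1) => // k /=; rewrite geq_max => /andP[Nk ik].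
  rewrite (fv i)// distrC; have [_ /(_ i.+1 ik) /=] := hphi k.
  by move=> /lt_trans; apply; exact: hN.
- by move=> k; have [_ /(_ 0%N (leq0n _))] := hphi k.
Qed.

(** For each [e] a tail of the sequence has cost at most [K + e] and utility at least [l - e]; the
    Fatou argument on tails yields one limit [g], after which [e] tends to 0. *)
Lemma attainable_of_approximation (g_ : nat -> T -> R) (K l : R) :
  (forall n, measurable_fun setT (g_ n)) -> (forall n w, 0 <= g_ n w) ->
  {ae P, forall w, cvgn (g_ ^~ w)} ->
  (forall n, P.-integrable setT (fun w => Ubar U (g_ n w))) ->
  (forall e, 0 < e -> exists N, forall n, (N <= n)%N ->
    (\int[P]_w (rho w * g_ n w)%:E <= (K + e)%:E)%E /\
    ((l - e)%:E <= \int[P]_w Ubar U (g_ n w))%E) ->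
  exists2 g, attainable P rho K g & (l%:E <= expected_utility P U g)%E.
Proof.
move=> mg g0 gc iU hN.
have [g [mg' g'0 gP]] := measurable_pointwise_limit mg g0.
have gc' : {ae P, forall w, g_ ^~ w @ \oo --> g w}.
  by move: gc; apply: filterS => w cw; rewrite (gP _ _ cw); exact: cw.
have key e : 0 < e -> (\int[P]_w (rho w * g w)%:E <= (K + e)%:E)%E /\
    ((l - e)%:E <= expected_utility P U g)%E.
  move=> e0; have [N hNe] := hN e e0.
  apply: (expected_utility_fatou (g_ := fun n => g_ (n + N)%N)) => //.
  - move: gc'; apply: filterS => w cw.
    by rewrite (@cvg_shiftn N _ (g_ ^~ w)).
  - by move=> n; have [] := hNe (n + N)%N (leq_addl _ _).
  - by move=> n; have [] := hNe (n + N)%N (leq_addl _ _).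
exists g; first split => //.
- by apply/lee_addgt0Pr => e /key[+ _]; rewrite EFinD.
- by apply/lee_addgt0Pr => e /key[_]; rewrite EFinB leeBlDr.
Qed.

Lemma exists_optimal (x0 : R) : 0 < x0 ->
  exists2 f, attainable P rho x0 f &
    value_function P rho x0 U = expected_utility P U f.
Proof.
move=> x00; set u := value_function _ _ _ _.
have le_u f : attainable P rho x0 f -> (expected_utility P U f <= u)%E.
  by move=> af; apply: ereal_sup_ubound; exists f.
have [uNy|uNy] := eqVneq u -oo%E.
  have a0 : attainable P rho x0 (cst 0).
    split => //; under eq_integral do rewrite /= mulr0.
    by rewrite integral0 lee_fin ltW.
  exists (cst 0) => //; apply/eqP; rewrite eq_le le_u// andbT uNy; exact: leNye.
(* The Fenchel inequality with multiplier 1 bounds the value by the integral of [V 1] plus [x0]. *)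
have [l ul] : exists l, u = l%:E.
  have iV := integrable_conjugate ltr01.
  suff : (u < +oo)%E by case: u uNy {le_u} => // l _ _; exists l.
  have [v VE] : exists v, (\int[P]_w (V 1 w)%:E)%E = v%:E.
    have := integrable_fin_num measurableT iV.
    by case: (integral _ _ _) => // v _; exists v.
  apply: (@le_lt_trans _ _ (v + x0)%:E); last exact: ltry.
  apply: ge_ereal_sup => _ [f [mf f0 fK] <-].
  have [->|EN] := eqVneq (expected_utility P U f) -oo%E; first exact: leNye.
  have iU : P.-integrable setT (fun w => Ubar U (f w)).
    apply: (expected_utility_integrable mf f0 fK).
    by rewrite ltNye.
  rewrite integrable_expected_utility//.
  have [iW WE] := integrable_conjugateD ltr01 mf f0 fK.
  apply: (@le_trans _ _ (\int[P]_w (V 1 w + 1 * rho w * f w)%:E)%E).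
    by apply: le_integral => // w _; exact: Ubar_le_conjugateD.
  by rewrite WE VE mul1e EFinD leeD2l.
have [k [k01 kni _ kc]] := exists_vanishing_seq R.
have hn n : exists f, attainable P rho x0 f /\ ((l - k n)%:E < expected_utility P U f)%E.
  have : ((l - k n)%:E < u)%E by rewrite ul lte_fin; have := k01 n; lra.
  by move=> /ereal_sup_gt[_ [f af <-] h]; exists f.
have [F hF] := choice hn.
have mF n : measurable_fun setT (F n) by have [[]] := hF n.
have F0 n w : 0 <= F n w by have [[_ + _]] := hF n; exact.
have FK n : (\int[P]_w (rho w * F n w)%:E <= x0%:E)%E by have [[]] := hF n.
have iUF n : P.-integrable setT (fun w => Ubar U (F n w)).
  apply: (expected_utility_integrable (mF n) (F0 n) (FK n)).
  by apply: lt_trans (hF n).2; exact: ltNyr.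
have lUF n : ((l - k n)%:E <= \int[P]_w Ubar U (F n w))%E.
  by rewrite -integrable_expected_utility//; exact: ltW (hF n).2.
suff [g_ [mg g0 gc iUg hg]] : exists g_ : nat -> T -> R,
   [/\ forall n, measurable_fun setT (g_ n), forall n w, 0 <= g_ n w,
       {ae P, forall w, cvgn (g_ ^~ w)},
       forall n, P.-integrable setT (fun w => Ubar U (g_ n w)) &
       forall e, 0 < e -> exists N, forall n, (N <= n)%N ->
         (\int[P]_w (rho w * g_ n w)%:E <= (x0 + e)%:E)%E /\
         ((l - e)%:E <= \int[P]_w Ubar U (g_ n w))%E].
  have [g ag lg] := attainable_of_approximation mg g0 gc iUg hg.
  by exists g => //; apply/eqP; rewrite eq_le le_u// andbT ul.
have Pfin : (P setT < +oo)%E by rewrite probability_setT ltry.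
have [A_ [aA naD]] := atomic_decomposition Pfin.
have [phi [c [phik c0 cvgA ac]]] := atoms_subsequence aA mF F0 FK.
set D := ~` _ in naD ac.
have mD : measurable D.
  apply: measurableC; apply: bigcup_measurable => i _.
  by have [->|[]] := aA i.
have DA w : ~ D w -> (\bigcup_i A_ i) w by rewrite /D/= => /contrapT.
pose f_ j := F (phi j).
have lUf j : ((l - k j)%:E <= \int[P]_w Ubar U (f_ j w))%E.
  apply: le_trans (lUF (phi j)); rewrite lee_fin lerD2l lerN2.
  exact: kni.
have irf j : P.-integrable setT (fun w => (rho w * f_ j w)%:E).
  exact: integrable_deflated (FK (phi j)).
have irfD j : P.-integrable D (fun w => (rho w * f_ j w)%:E) by exact: integrableS (irf j).
pose a j := fine (\int[P]_(w in D) (rho w * f_ j w)%:E)%E.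
have aE j : (\int[P]_(w in D) (rho w * f_ j w)%:E = (a j)%:E)%E.
  by rewrite fineK// integrable_fin_num.
have {}ac j : `|a j - c| < 1 / (2 ^ j.+1)%:R by exact: ac.
(* For [c = 0] the costs on [D] are below a geometric sequence, so the selected payoffs themselves
   tend to 0 a.e. on [D]. *)
have [c_gt0|c_le0] := ltP 0 c; last first.
  have cE : c = 0 by apply/eqP; rewrite eq_le c0 c_le0.
  have cvgD : {ae P, forall w, D w -> (fun j => rho w * f_ j w) @ \oo --> 0}.
    apply: ae_cvg0_of_summable => //.
    - by move=> j; apply: measurable_funTS; apply: measurable_funM => //; exact: mF.
    - by move=> j w; rewrite mulr_ge0 ?F0// ltW.
    - move=> j; rewrite aE lee_fin; apply: le_trans (ltW (ac j)).
      by rewrite cE subr0; exact: ler_norm.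
  exists f_; split => //; [by move=> n; exact: mF|by move=> n w; exact: F0|..].
  - apply: filterS2 cvgA cvgD => w hA hD.
    have [/hD rf0|/DA/hA//] := pselect (D w).
    apply/cvg_ex; exists ((rho w)^-1 * 0).
    have -> : f_ ^~ w = (fun j => (rho w)^-1 * (rho w * f_ j w)).
      by apply/funext => j; rewrite mulKf// gt_eqF.
    by apply: cvgM => //; exact: cvg_cst.
  - by move=> n; exact: iUF.
  - move=> e e0; have [N hN] := kc e e0; exists N => n /hN kn; split.
      by apply: le_trans (FK _) _; rewrite lee_fin lerDl ltW.
    by apply: le_trans (lUf n); rewrite lee_fin; lra.
have [y [fD [y0 mfD fD0 maxD [Sc yS]]]] :=
  nonatomic_lagrangian mD naD c_gt0.
(* Removing the exceptional null set makes [fD] optimal everywhere on [D'] without changing the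
   integrals. *)
have [N [mN PN0 subN]] := maxD.
pose D' := D `\` N.
have mD' : measurable D' by exact: measurableD.
have irfD0 : P.-integrable D (fun w => (rho w * fD w)%:E).
  apply/integrableP; split.
    by apply/measurable_EFinP; apply: measurable_funTS; exact: measurable_funM.
  rewrite (eq_integral (fun w => (rho w * fD w)%:E)).
    by apply: le_lt_trans Sc _; exact: ltry.
  by move=> w _; rewrite gee0_abs// lee_fin mulr_ge0// ltW.
have [S SE] : exists S, (\int[P]_(w in D) (rho w * fD w)%:E)%E = S%:E.
  have := integrable_fin_num mD irfD0.
  by case: (integral _ _ _) => // S _; exists S.
move: Sc yS; rewrite SE lee_fin -EFinM => Sc [yS].
have maxD' w : D' w -> maximizer U (y * rho w) (fD w).
  by move=> [Dw Nw]; apply: contrapT => h; apply: Nw; apply: subN => /= /(_ Dw).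
have SE' : (\int[P]_(w in D') (rho w * fD w)%:E = S%:E)%E.
  by rewrite -SE [RHS](negligible_integral mN).
have aE' j : (\int[P]_(w in D') (rho w * f_ j w)%:E = (a j)%:E)%E.
  by rewrite -aE [RHS](negligible_integral mN).
have imp j := lagrangian_improvement mD' y0 mfD fD0 maxD' SE' (mF (phi j))
  (F0 (phi j)) (FK (phi j)) (iUF (phi j)) (aE' j).
exists (fun j w => f_ j w + \1_D' w * (fD w - f_ j w)); split.
- by move=> j; have [] := imp j.
- by move=> j; have [] := imp j.
- have aeN : {ae P, forall w, ~ N w}.
    by exists N; split => // w /= /contrapT.
  apply: filterS2 cvgA aeN => w hA nN.
  rewrite indicE; have [Dw|nDw] := pselect (D w).
    rewrite mem_set//=; under eq_fun do rewrite mul1r addrC subrK.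
    exact: is_cvg_cst.
  rewrite memNset; last by move=> [].
  by under eq_fun do rewrite mul0r addr0; exact: hA (DA w nDw).
- by move=> j; have [] := imp j.
(* With [|a n - c| < r] and [r * (y + 1) = e / 2], the extra cost [S - a n <= c - a n] is below [e].
   By slackness [y * (S - a n) = y * (c - a n) >= - y * r], so this loss and [k n < e / 2] add up to
   at most [e]. *)
move=> e e0; have e2 : 0 < e / (2 * (y + 1)) by rewrite divr_gt0//; lra.
have e22 : 0 < e / 2 by lra.
have [N1 hN1] := near_inv_pow2_lt e2; have [N2 hN2] := kc _ e22.
exists (maxn N1 N2) => n; rewrite geq_max => /andP[/hN1 h1 /hN2 h2].
have can := lt_trans (ac n) h1.
have ey : e / (2 * (y + 1)) * (y + 1) = e / 2.
  by rewrite invfM mulrA mulfVK// gt_eqF//; lra.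
set r := e / (2 * (y + 1)) in e2 can ey h1.
have yr : 0 <= y * r by rewrite mulr_ge0// ltW.
have [can1 can2] : c - a n < r /\ a n - c < r.
  by move: can; rewrite ltr_norml => /andP[]; lra.
have [_ _ IE _ UE] := imp n; split.
  rewrite IE [leRHS]EFinD; apply: leeD; first exact: FK.
  by rewrite lee_fin; lra.
apply: le_trans UE; apply: (@le_trans _ _ ((l - k n)%:E + (y * (S - a n))%:E)%E).
  have yca : y * (a n - c) <= y * r by rewrite ler_wpM2l// ltW.
  by rewrite -EFinD lee_fin; lra.
by rewrite leeD2r.
Qed.

End OptimalPayoff.

Theorem theorem3p3 (R : realType) (d : measure_display)
  (Omega : measurableType d) (P : probability Omega R)
  (Th : R) (F : R -> set (set Omega)) (lam : R) (S Z0 Z1 : R -> Omega -> R)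
  (U : R -> R) :
  0 < Th ->
  filtration Th F -> usual_conditions P Th F ->
  0 < lam < 1 ->
  (forall t, in_time Th t -> forall w, 0 < S t w) ->
  cadlag Th S -> adapted Th F S ->
  consistent_price_system P Th F lam S Z0 Z1 ->
  utility U ->
  (forall y, 0 < y -> (\int[P]_w conjugate U (y * Z0 Th w) < +oo)%E) ->
  forall x0, 0 < x0 ->
  exists2 f, attainable P (Z0 Th) x0 f &
    value_function P (Z0 Th) x0 U = expected_utility P U f.
Proof.
move=> Th0 _ _ _ _ _ _ [Zpos [_ [[_ [iZ _]] _]]] HU Vfin x0 x00.
(* The density [Z0 Th] is positive, and it is integrable, hence measurable, as the terminal value of
   a martingale. *)
have inTh : in_time Th Th by rewrite /in_time lexx ltW.
have iZT := iZ _ inTh.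
apply: (exists_optimal HU _ _ iZT Vfin x00).
  by move=> w; have [] := Zpos _ inTh w.
by apply/measurable_EFinP; exact: measurable_int iZT.
Qed.
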